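(* Let $n\ge0$ be an integer and $x>0$. Then, with the same choice of sign throughout, $$\left.\frac{\partial \mathrm{W}_{\kappa,\mu}(x)}{\partial\mu}\right|_{\kappa=n/2,\ \mu=\pm(n+1)/2}=\pm x^{-n/2}e^{x/2}\,\mathrm{E}_1(x)\,\Gamma(1+n,x)\pm n!\,x^{n/2}e^{-x/2}\sum_{k=0}^{n}\frac{x^{-k}}{(n-k)!}\left\{H_k+(-1)^{k+1}\,\Gamma(-k,x)\,\gamma(k+1,-x)-\sum_{\ell=1}^{k}\binom{k}{\ell}(-x)^{-\ell}\gamma(\ell,x)\right\}.$$
   Context: For $x>0$, the Whittaker function is $\mathrm{W}_{\kappa,\mu}(x)=e^{-x/2}x^{\mu+1/2}\,\mathrm{U}\left(\frac12+\mu-\kappa,1+2\mu,x\right)$, where $\mathrm{U}$ is the Tricomi confluent hypergeometric function. $\gamma(\nu,z)=\int_0^z t^{\nu-1}e^{-t}\,dt$ ($\mathrm{Re}\,\nu>0$) and $\Gamma(\nu,z)=\int_z^\infty t^{\nu-1}e^{-t}\,dt$ are the lower and upper incomplete gamma functions. $\mathrm{E}_1(x)=\int_x^\infty\frac{e^{-t}}{t}\,dt$ is the exponential integral. $H_k=\sum_{j=1}^k\frac1j$ is the $k$-th harmonic number ($H_0=0$). *)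

(* Defs.v *)
From HB Require Import structures.
From mathcomp Require Import all_boot all_order all_algebra.
From mathcomp Require Import all_classical all_reals all_analysis.

Set Implicit Arguments.
Unset Strict Implicit.
Unset Printing Implicit Defensive.

Import Order.TTheory GRing.Theory Num.Theory.
Import numFieldNormedType.Exports.

Local Open Scope classical_set_scope.
Local Open Scope ring_scope.

(* Tricomi's U(a, b, .) is the solution on (0, +oo) of Kummer's equation
     x u'' + (b - x) u' - a u = 0
   normalized by u(x) ~ x^(-a) as x -> +oo.  This fixes u on (0, +oo) for all
   real a, b, integers included: every solution not proportional to U grows
   like e^x x^(a - b). *)
Definition is_tricomiU (R : realType) (a b : R) (u : R -> R) : Prop :=
  (forall x : R, 0 < x ->
     [/\ derivable u x 1,
         derivable (u^`())%classic x 1 &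
         x * (u^`()^`())%classic x + (b - x) * (u^`())%classic x - a * u x = 0])
  /\ (x `^ a * u x @[x --> +oo] --> (1 : R)).

(* Only the values at x > 0 are meaningful. *)
Definition tricomiU (R : realType) (a b : R) : R -> R :=
  xget (fun=> 0) [set u | is_tricomiU a b u].

Definition whittakerW (R : realType) (kappa mu x : R) : R :=
  expR (- x / 2) * x `^ (mu + 1 / 2) *
  tricomiU (1 / 2 + mu - kappa) (1 + 2 * mu) x.

(* The orders are integers: then t^(nu - 1) makes sense for t < 0 as well, as
   is needed for gamma(nu, z) at negative z, where the integral from 0 to z is
   minus the integral over [z, 0]. *)
Definition lower_gamma (R : realType) (nu : int) (z : R) : R :=
  if 0 <= z
  then \int[@lebesgue_measure R]_(t in `[0, z]) (t ^ (nu - 1) * expR (- t))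
  else - \int[@lebesgue_measure R]_(t in `[z, 0]) (t ^ (nu - 1) * expR (- t)).

Definition upper_gamma (R : realType) (nu : int) (z : R) : R :=
  \int[@lebesgue_measure R]_(t in `[z, +oo[) (t ^ (nu - 1) * expR (- t)).

Definition expint_E1 (R : realType) (x : R) : R :=
  \int[@lebesgue_measure R]_(t in `[x, +oo[) (expR (- t) / t).

Definition harmonic_number (R : realType) (k : nat) : R :=
  \sum_(1 <= j < k.+1) j%:R^-1.

(* Main.v *)
Require Import Defs.
From mathcomp Require Import all_boot all_order all_algebra.
From mathcomp Require Import all_classical all_reals all_analysis.
From mathcomp Require Import measurable_realfun ring lra.

Set Implicit Arguments.
Unset Strict Implicit.
Unset Printing Implicit Defensive.

Import Order.TTheory GRing.Theory Num.Theory.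
Import numFieldNormedType.Exports.

Local Open Scope classical_set_scope.
Local Open Scope ring_scope.

(** Write J(p, q) for the integral of e^(-x t) t^p (1 + t)^q over t > 0.
    Then J(a - 1, b - a - 1) / Gamma(a) solves Kummer's equation with the right
    normalization at infinity, and a Wronskian argument shows that it is the
    only such solution; Kummer's symmetry u |-> x^(b - 1) u makes W even in mu,
    so only the sign + matters.  At kappa = n/2, mu = (n + 1)/2 + e this gives
      W = e^(-x/2) x^(n/2) J(e, n + e) / J(e, 0).
    Differentiating under the integral at e = 0 and expanding (1 + t)^n leaves
    the moments of t^k ln t and t^k ln (1 + t).  Their recurrences in k are the
    derivatives in p and q of the integration by parts
      x J(p + 1, q) = (p + 1) J(p, q) + q J(p + 1, q - 1).
    The first family yields the harmonic numbers; the second is summed with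
    J(k, -1) = k! e^x Gamma(-k, x) and the recurrences of the incomplete gamma
    functions. *)

(** * Integrals over the positive half-line *)

(** The kernel is kept as the exponential of an expression affine in x, p and q, so one theorem on
    integrals of [expR (A t + y * g t)] yields the derivatives in all three parameters;
    differentiating along lines in the (p, q)-plane avoids calculus in two variables. Gamma(a)
    appears only as the integral J(a - 1, 0) at x = 1; scaling brings it to the same x as the
    numerator, which leaves mu in the exponents alone. The integral for U requires a > 0. Near mu =
    (n + 1)/2, a = 1/2 + mu - kappa is close to 1; near mu = -(n + 1)/2 it is close to -n, so the
    reflection in mu has to go through the uniqueness of the normalized solution. The integral of
    e^(-x t) ln t, which involves Euler's constant and ln x, is never evaluated: numerator and
    denominator contribute it with equal coefficients. E_1(x) arises from the integral of e^(-x t)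
    ln (1 + t) and is a common summand of all normalized moments of ln (1 + t), so it ends up
    multiplying the finite exponential sum of Gamma(1 + n, x). *)

Lemma is_derive1_continuous (R : realType) (f : R -> R) (t df : R) :
  is_derive t 1 f df -> {for t, continuous f}.
Proof. by case=> /derivable1_diffP/differentiable_continuous. Qed.

Section integral_pos.
Context {R : realType}.
Notation mu := (@lebesgue_measure R).
Notation Rpos := (`](0 : R), +oo[%classic).
Implicit Types (f F A g h : R -> R) (t x y p q : R) (n : nat).

Definition int_pos f : R := \int[mu]_(t in Rpos) f t.

Definition integrable_pos f : Prop := mu.-integrable Rpos (EFin \o f).

(** Compact intervals exhausting the half-line, on which the fundamental theorem for segments
    applies; the shift by 2 keeps the endpoints distinct already at [n = 0]. *)
Let itv_n (n : nat) : set R := `[n.+2%:R^-1, n.+2%:R].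

Let itv_n_lt (n : nat) : n.+2%:R^-1 < n.+2%:R :> R.
Proof.
by rewrite (@lt_trans _ _ 1) ?invf_lt1 ?ltr1n.
Qed.

Let itv_n_pos n : itv_n n `<=` Rpos.
Proof.
move=> t; rewrite /itv_n/= !in_itv/= => /andP[t0 _].
by rewrite andbT (lt_le_trans _ t0)// invr_gt0.
Qed.

Let itv_n_near t : 0 < t -> \forall n \near \oo, itv_n n t.
Proof.
move=> t0; near=> n; rewrite /itv_n/= in_itv/=; apply/andP; split.
  have : t^-1 <= n%:R by near: n; exact: nbhs_infty_ger.
  rewrite -lef_pV2 ?posrE ?invr_gt0 ?ltr0n//; last by near: n; exact: nbhs_infty_gt.
  rewrite invrK; apply: le_trans; rewrite lef_pV2 ?posrE ?ler_nat ?ltr0n//.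
    exact: leq_trans (leqnSn _) (leqnSn _).
  by near: n; exact: nbhs_infty_gt.
have : t <= n%:R by near: n; exact: nbhs_infty_ger.
by move/le_trans; apply; rewrite ler_nat; exact: leq_trans (leqnSn _) (leqnSn _).
Unshelve. all: by end_near. Qed.

Let bigcup_itv_n : \bigcup_n itv_n n = Rpos.
Proof.
apply/seteqP; split=> [t [n _ /itv_n_pos//]|t /=].
rewrite in_itv/= andbT => /itv_n_near[n _ /(_ n (leqnn n))]; by exists n.
Qed.

Let mitv : measurable (Rpos : set (measurableTypeR R)).
Proof. exact: measurable_itv. Qed.

Lemma measurable_pos f : (forall t, 0 < t -> {for t, continuous f}) ->
  measurable_fun Rpos f.
Proof.
move=> cf; apply: open_continuous_measurable_fun => //.
by move=> t; rewrite inE/= in_itv/= andbT => /cf.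
Qed.

Lemma integral_segment_FTC f F (a b : R) : a < b ->
  (forall t, a <= t <= b -> is_derive t 1 F (f t)) ->
  {within `[a, b], continuous f} ->
  (\int[mu]_(t in `[a, b]) (f t)%:E)%E = (F b - F a)%:E.
Proof.
move=> ab dF cf; rewrite EFinB; apply: continuous_FTC2 => //; last first.
  move=> t; rewrite in_itv/= => /andP[/ltW at_ /ltW tb].
  by rewrite derive1E; apply: derive_val; apply: dF; rewrite at_ tb.
have cF t : a <= t <= b -> {for t, continuous F}.
  by move=> /dF; exact: is_derive1_continuous.
split.
- by move=> t; rewrite in_itv/= => /andP[/ltW at_ /ltW tb]; case: (dF t _) => //; rewrite at_.
- by apply: cvg_at_right_filter; apply: cF; rewrite lexx ltW.
- by apply: cvg_at_left_filter; apply: cF; rewrite lexx ltW.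
Qed.

Let integral_itv_n f F n :
  (forall t, 0 < t -> is_derive t 1 F (f t)) ->
  (forall t, 0 < t -> {for t, continuous f}) ->
  (\int[mu]_(t in itv_n n) (f t)%:E)%E = (F n.+2%:R - F n.+2%:R^-1)%:E.
Proof.
move=> dF cf; apply: integral_segment_FTC => //.
  move=> t /andP[t0 _]; apply: dF; rewrite (lt_le_trans _ t0)// invr_gt0.
apply: continuous_in_subspaceT => t; rewrite inE => /itv_n_pos/=.
by rewrite in_itv/= andbT => /cf.
Qed.

(** Monotone convergence along [itv_n]: each truncated integral is a difference of two values of
    [F], hence at most [B + B]. It serves for one explicit kernel, with which the others are
    compared. *)
Lemma integrable_pos_FTC f F (B : R) : (forall t, 0 < t -> 0 <= f t) ->
  (forall t, 0 < t -> {for t, continuous f}) ->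
  (forall t, 0 < t -> is_derive t 1 F (f t)) ->
  (forall t, 0 < t -> `|F t| <= B) -> integrable_pos f.
Proof.
move=> f0 cf dF FB.
have mf : measurable_fun Rpos (EFin \o f).
  by apply/measurable_EFinP; exact: (measurable_pos cf).
have f0E t : Rpos t -> (0%R <= (f t)%:E)%E.
  by rewrite /= in_itv/= andbT lee_fin; exact: f0.
apply/integrableP; split => //.
have -> : (\int[mu]_(t in Rpos) `|(EFin \o f) t| = \int[mu]_(t in Rpos) (f t)%:E)%E.
  by apply: eq_integral => t; rewrite inE => /f0E; exact: gee0_abs.
rewrite -bigcup_itv_n.
have ndF : {homo itv_n : n m / (n <= m)%N >-> (n <= m)%O}.
  move=> n m nm; rewrite subsetEset => t; rewrite /itv_n/= !in_itv/=.
  move=> /andP[a b]; rewrite (le_trans _ a) ?(le_trans b) ?ler_nat ?ltnS//.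
  by rewrite lef_pV2 ?posrE ?ltr0n ?ler_nat ?ltnS.
have mfi i : measurable_fun (itv_n i) (EFin \o f).
  exact: measurable_funS mf.
have cvgI := @ge0_nondecreasing_set_cvg_integral _ (measurableTypeR R) R itv_n
  (EFin \o f) lebesgue_measure ndF (fun i => measurable_itv _) mfi
  (fun i t it => f0E _ (@itv_n_pos i _ it)).
apply: (@le_lt_trans _ _ (B + B)%:E); last exact: ltry.
rewrite -(cvg_lim _ cvgI)//; apply: lime_le; first by apply/cvg_ex; eexists; exact: cvgI.
near=> n; rewrite /= (integral_itv_n n dF cf) lee_fin.
have := FB n.+2%:R; rewrite ltr0n => /(_ isT).
have := FB n.+2%:R^-1; rewrite invr_gt0 ltr0n => /(_ isT).
by rewrite !ler_norml => /andP[? ?] /andP[? ?]; lra.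
Unshelve. all: by end_near. Qed.

(** Dominated convergence along [itv_n], with [|f|] as majorant; [f] may change sign here, so
    integrability is assumed rather than drawn from a bound on [F]. *)
Lemma int_pos_FTC f F (l0 l1 : R) :
  (forall t, 0 < t -> {for t, continuous f}) ->
  (forall t, 0 < t -> is_derive t 1 F (f t)) ->
  integrable_pos f ->
  F t @[t --> 0^'+] --> l0 -> F t @[t --> +oo] --> l1 ->
  int_pos f = l1 - l0.
Proof.
move=> cf dF intf F0 F1.
have mf : measurable_fun Rpos (EFin \o f) by case/integrableP: intf.
have f_f : {ae mu, forall t, Rpos t ->
    ((EFin \o f) \_ (itv_n n) t)%E @[n --> \oo] --> (f t)%:E}.
  apply: aeW => t; rewrite /= in_itv/= andbT => /itv_n_near[N _ HN].
  apply: cvg_near_cst; exists N => // n /= Nn; rewrite patchE.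
  by rewrite mem_set//; exact: HN.
have bnd : {ae mu, forall t (n : nat), Rpos t ->
    (`|((EFin \o f) \_ (itv_n n)) t| <= `|(f t)%:E|)%E}.
  apply: aeW => t n _; rewrite patchE; case: ifP => //= _.
  by rewrite normr0 lee_fin.
have mfn n : measurable_fun Rpos ((EFin \o f) \_ (itv_n n)).
  apply/(measurable_restrict _ _ _) => //; first exact: measurable_itv.
  by apply: measurable_funS mf => //; exact: subIsetl.
have [_ _ cvgI] := @dominated_convergence _ (measurableTypeR R) R
  lebesgue_measure Rpos mitv (fun n => (EFin \o f) \_ (itv_n n)) (EFin \o f)
  (abse \o (EFin \o f)) mfn mf f_f (integrable_abse intf) bnd.
have cvgF : (F n.+2%:R - F n.+2%:R^-1)%:E @[n --> \oo] --> (l1 - l0)%:E.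
  apply: cvg_EFin; first exact: nearW.
  apply: cvgB.
    apply: ((cvg_pinftyP F l1).1 F1).
    apply/cvgryPge => A; near=> n; apply: (@le_trans _ _ n%:R).
      by near: n; exact: nbhs_infty_ger.
    by rewrite ler_nat; exact: leq_trans (leqnSn _) (leqnSn _).
  apply: ((cvg_at_rightP F 0 l0).1 F0); split=> [n|].
    by rewrite invr_gt0 ltr0n.
  by have := @cvg_harmonic R; rewrite -cvg_shiftS.
have {}cvgI : (F n.+2%:R - F n.+2%:R^-1)%:E @[n --> \oo] -->
    (\int[mu]_(t in Rpos) (f t)%:E)%E.
  apply: cvg_trans cvgI; apply: near_eq_cvg; near=> n.
  rewrite -(integral_itv_n n dF cf) /= -integral_mkcondr (setIidr (@itv_n_pos n)).
  by [].
have E := cvg_unique (@ereal_hausdorff _) cvgF cvgI.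
by rewrite /int_pos /Rintegral -E.
Unshelve. all: by end_near. Qed.

Lemma measurable_of_integrable_pos f : integrable_pos f -> measurable_fun Rpos f.
Proof. by case/integrableP => /measurable_EFinP. Qed.

Lemma le_integrable_pos f g : measurable_fun Rpos f ->
  (forall t, 0 < t -> `|f t| <= g t) -> integrable_pos g -> integrable_pos f.
Proof.
move=> mf fg; apply: le_integrable => //; first exact/measurable_EFinP.
move=> t; rewrite /= in_itv/= andbT => /fg fgt.
by rewrite lee_fin (le_trans fgt)// ler_norm.
Qed.

Lemma eq_int_pos f g : (forall t, 0 < t -> f t = g t) -> int_pos f = int_pos g.
Proof.
by move=> fg; apply: eq_Rintegral => t; rewrite inE/= in_itv/= andbT => /fg.
Qed.

Lemma eq_integrable_pos f g : (forall t, 0 < t -> f t = g t) ->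
  integrable_pos f -> integrable_pos g.
Proof.
move=> fg; apply: eq_integrable => // t.
by rewrite inE/= in_itv/= andbT => /fg ->.
Qed.

Lemma integrable_posD f g : integrable_pos f -> integrable_pos g ->
  integrable_pos (fun t => f t + g t).
Proof.
move=> intf intg; have := integrableD mitv intf intg.
by apply: eq_integrable => // t _; rewrite /= EFinD.
Qed.

Lemma integrable_posZ (c : R) f : integrable_pos f ->
  integrable_pos (fun t => c * f t).
Proof.
move=> intf; have := integrableZl mitv c intf.
by apply: eq_integrable => // t _; rewrite /= EFinM.
Qed.

Lemma int_posD f g : integrable_pos f -> integrable_pos g ->
  int_pos (fun t => f t + g t) = int_pos f + int_pos g.
Proof. exact: RintegralD. Qed.

Lemma int_posZ (c : R) f : integrable_pos f ->
  int_pos (fun t => c * f t) = c * int_pos f.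
Proof. exact: RintegralZl. Qed.

Lemma le_int_pos f g : integrable_pos f -> integrable_pos g ->
  (forall t, 0 < t -> f t <= g t) -> int_pos f <= int_pos g.
Proof.
move=> intf intg fg; apply: le_Rintegral => // t.
by rewrite /= in_itv/= andbT => /fg.
Qed.

Lemma norm_int_pos_le f : integrable_pos f ->
  `|int_pos f| <= int_pos (fun t => `|f t|).
Proof. exact: le_normr_Rintegral. Qed.

Let expRB_bound (s z : R) : s * expR (z - s) <= expR z.
Proof.
have -> : expR z = expR s * expR (z - s) by rewrite -expRD addrC subrK.
rewrite ler_wpM2r ?expR_ge0//; apply: le_trans (expR_ge1Dx s).
by rewrite lerDr.
Qed.

(** The majorant, uniform in [y], for differentiation under the integral. The factor [|g|] is
    absorbed by [s <= expR s] at [s = d / 2 * |g|]; the exponent then stays below its value at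
    [y0 + d] or [y0 - d], according to the sign of [g]. *)
Let expR_family_bound (a g y y0 d : R) : 0 < d -> `|y - y0| <= d / 2 ->
  `|g| * expR (a + y * g) <=
  2 / d * (expR (a + (y0 + d) * g) + expR (a + (y0 - d) * g)).
Proof.
move=> d0; rewrite ler_distlC => /andP[y1 y2].
have d20 : 0 < d / 2 by rewrite divr_gt0.
rewrite -(ler_pM2l d20) mulrA [leRHS]mulrA.
have -> : d / 2 * (2 / d) = 1 by field; rewrite gt_eqF.
rewrite mul1r.
have [g0|g0] := leP 0 g.
  rewrite ler_wpDr ?expR_ge0//; apply: le_trans (expRB_bound (d / 2 * g) _).
  rewrite ger0_norm//; apply: ler_wpM2l; first by rewrite mulr_ge0// ltW.
  rewrite ler_expR.
  by have : y * g <= (y0 + d / 2) * g; [rewrite ler_wpM2r//; lra|lra].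
rewrite ler_wpDl ?expR_ge0//; apply: le_trans (expRB_bound (d / 2 * - g) _).
rewrite ltr0_norm//; apply: ler_wpM2l.
  by rewrite mulr_ge0 ?oppr_ge0// ltW.
rewrite ler_expR.
by have : y * g <= (y0 - d / 2) * g; [rewrite ler_wnM2r ?(ltW g0)//; lra|lra].
Qed.

(** For fixed [t] the exponent is affine in [y], so between the two endpoints the integrand is at
    most the larger of its end values, hence at most their sum. *)
Lemma integrable_pos_expR_convex A g (y0 y d : R) :
  (forall t, 0 < t -> {for t, continuous A}) ->
  (forall t, 0 < t -> {for t, continuous g}) ->
  integrable_pos (fun t => expR (A t + (y0 - d) * g t)) ->
  integrable_pos (fun t => expR (A t + (y0 + d) * g t)) ->
  `|y - y0| <= d -> integrable_pos (fun t => expR (A t + y * g t)).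
Proof.
move=> cA cg i1 i2 yd.
apply: le_integrable_pos (integrable_posD i1 i2).
  apply: measurable_pos => t t0; apply: continuous_comp.
    by apply: continuousD; [exact: cA|apply: continuousM; [exact: cst_continuous|exact: cg]].
  exact: continuous_expR.
move=> t t0; rewrite ger0_norm ?expR_ge0//.
move: yd; rewrite ler_distlC => /andP[y1 y2].
have [g0|g0] := leP 0 (g t).
  rewrite ler_wpDl ?expR_ge0// ler_expR lerD2l ler_wpM2r//; lra.
rewrite ler_wpDr ?expR_ge0// ler_expR lerD2l ler_wnM2r ?(ltW g0)//; lra.
Qed.

Lemma is_derive_int_pos_expR A g (y0 d : R) : 0 < d ->
  (forall t, 0 < t -> {for t, continuous A}) ->
  (forall t, 0 < t -> {for t, continuous g}) ->
  integrable_pos (fun t => expR (A t + (y0 - d) * g t)) ->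
  integrable_pos (fun t => expR (A t + (y0 + d) * g t)) ->
  integrable_pos (fun t => g t * expR (A t + y0 * g t)) /\
  is_derive y0 1 (fun y => int_pos (fun t => expR (A t + y * g t)))
    (int_pos (fun t => g t * expR (A t + y0 * g t))).
Proof.
move=> d0 cA cg i1 i2.
pose G t := 2 / d * (expR (A t + (y0 + d) * g t) + expR (A t + (y0 - d) * g t)).
have G0 t : 0 <= G t by rewrite mulr_ge0 ?addr_ge0 ?expR_ge0// divr_ge0// ltW.
have intG : integrable_pos G by apply: integrable_posZ; exact: integrable_posD.
have ce y t : 0 < t -> {for t, continuous (fun t => expR (A t + y * g t))}.
  move=> t0; apply: continuous_comp; last exact: continuous_expR.
  by apply: continuousD; [exact: cA|apply: continuousM; [exact: cst_continuous|exact: cg]].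
have de y t : is_derive y 1 (fun y => expR (A t + y * g t)) (g t * expR (A t + y * g t)).
  by apply: is_derive_eq; rewrite /GRing.scale/=; ring.
have near_y y : y \in `](y0 - d / 2), (y0 + d / 2)[ -> `|y - y0| <= d / 2.
  by rewrite in_itv/= ler_distlC => /andP[? ?]; apply/andP; split; lra.
have y0I : `](y0 - d / 2), (y0 + d / 2)[%classic y0.
  by rewrite /= in_itv/= ltrDl gtrBl divr_gt0.
have intf y : `](y0 - d / 2), (y0 + d / 2)[%classic y ->
    integrable_pos (fun t => expR (A t + y * g t)).
  move=> /near_y yd; apply: (integrable_pos_expR_convex cA cg i1 i2).
  by rewrite (le_trans yd)//; lra.
split.
  apply: le_integrable_pos intG.
    by apply: measurable_pos => t t0; apply: continuousM; [exact: cg|exact: ce].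
  move=> t _; rewrite normrM (ger0_norm (expR_ge0 _)).
  by apply: expR_family_bound; rewrite // subrr normr0 divr_ge0// ltW.
have der y t : `](y0 - d / 2), (y0 + d / 2)[%classic y -> Rpos t ->
    derivable (fun y => expR (A t + y * g t)) y 1 by move=> _ _; case: (de y t).
have parE y t : partial1of2 (fun y t => expR (A t + y * g t)) y t =
    g t * expR (A t + y * g t).
  by rewrite /partial1of2 derive1E; case: (de y t).
have bnd y t : `](y0 - d / 2), (y0 + d / 2)[%classic y -> Rpos t ->
    `|partial1of2 (fun y t => expR (A t + y * g t)) y t| <= G t.
  move=> /near_y yd _; rewrite parE normrM (ger0_norm (expR_ge0 _)).
  exact: expR_family_bound.
have D1 := @derivable_under_integral R _ (measurableTypeR R) lebesgue_measure
  (fun y t => expR (A t + y * g t)) _ mitv _ _ _ y0I intf der G G0 intG bnd.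
have D2 := @differentiation_under_integral R _ (measurableTypeR R) lebesgue_measure
  (fun y t => expR (A t + y * g t)) _ mitv _ _ _ y0I intf der G G0 intG bnd.
apply: DeriveDef => //; rewrite -derive1E.
by apply: (eq_trans D2); apply: eq_Rintegral => t _; exact: parE.
Qed.

End integral_pos.

(** * The integrals defining Tricomi's function *)

Section tricomi_kernel.
Context {R : realType}.
Implicit Types (x p q c t y : R).

(* For [t > 0] this is [e^(-x t) t^p (1 + t)^q]. *)
Definition tricomi_ker x p q t : R :=
  expR (- (x * t) + p * ln t + q * ln (1 + t)).

Definition tricomi_int x p q : R := int_pos (tricomi_ker x p q).

Lemma tricomi_ker_ge0 x p q t : 0 <= tricomi_ker x p q t.
Proof. exact: expR_ge0. Qed.

Lemma tricomi_kerDp x p q t : 0 < t ->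
  tricomi_ker x (p + 1) q t = t * tricomi_ker x p q t.
Proof.
move=> t0; rewrite /tricomi_ker -[X in _ = X * _](lnK t0) -expRD; congr expR; ring.
Qed.

Lemma tricomi_kerDq x p q t : 0 < t ->
  tricomi_ker x p (q + 1) t = (1 + t) * tricomi_ker x p q t.
Proof.
move=> t0; have t1 : 0 < 1 + t by rewrite addr_gt0.
rewrite /tricomi_ker -[X in _ = X * _](lnK t1) -expRD; congr expR; ring.
Qed.

Lemma is_derive_tricomi_ker x p q t : 0 < t ->
  is_derive t 1 (tricomi_ker x p q)
    ((- x + p / t + q / (1 + t)) * tricomi_ker x p q t).
Proof.
move=> t0; have t1 : 0 < 1 + t by rewrite addr_gt0.
have ? := is_derive1_ln t0; have ? := is_derive1_ln t1.
rewrite /tricomi_ker; apply: is_derive_eq.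
by rewrite /GRing.scale/=; ring.
Qed.

Lemma continuous_tricomi_ker x p q t : 0 < t ->
  {for t, continuous (tricomi_ker x p q)}.
Proof.
by move=> /(is_derive_tricomi_ker x p q); exact: is_derive1_continuous.
Qed.

(** [ln s <= s] at [s = d * (1 + t)], with the slope [d] chosen so that [|c| * d <= x]. In other
    words, a power of [1 + t] is at most a constant times [expR (x * t)]. *)
Lemma ln1D_le_affine c x : 0 < x ->
  exists M, forall t, 0 < t -> c * ln (1 + t) <= x * t + M.
Proof.
move=> x0; pose d := x / (`|c| + 1).
have c1 : 0 < `|c| + 1 by rewrite ltr_wpDl.
have d0 : 0 < d by rewrite divr_gt0.
exists (x - `|c| * ln d) => t t0; have t1 : 0 < 1 + t by rewrite addr_gt0.
have l0 : 0 <= ln (1 + t) by rewrite ln_ge0// lerDl ltW.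
apply: (@le_trans _ _ (`|c| * ln (1 + t))).
  by rewrite ler_wpM2r// ler_norm.
have : ln (d * (1 + t)) <= d * (1 + t) by rewrite ltW// ln_sublinear// mulr_gt0.
rewrite lnM ?posrE// => h.
have h2 : `|c| * d <= x.
  by rewrite /d mulrA ler_pdivrMr// mulrC ler_wpM2l ?(ltW x0)// lerDl.
have h3 : `|c| * (ln d + ln (1 + t)) <= `|c| * (d * (1 + t)) by rewrite ler_wpM2l.
have h4 : `|c| * d * (1 + t) <= x * (1 + t) by rewrite ler_wpM2r// ltW.
lra.
Qed.

(** The exponents are chosen for an elementary primitive: t^p (1 + t)^(-p-2) is the derivative of (t
    / (1 + t))^(p+1) / (p + 1), which lies between 0 and 1 / (p + 1). *)
Let integrable_tricomi_ker0 p : -1 < p -> integrable_pos (tricomi_ker 0 p (- p - 2)).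
Proof.
move=> p1; have p0 : 0 < p + 1 by lra.
pose F t := (p + 1)^-1 * tricomi_ker 0 (p + 1) (- p - 1) t.
apply: (@integrable_pos_FTC _ (tricomi_ker 0 p (- p - 2)) F (p + 1)^-1) => t t0.
- exact: tricomi_ker_ge0.
- exact: continuous_tricomi_ker.
- have h := is_derive_tricomi_ker 0 (p + 1) (- p - 1) t0.
  apply: is_derive_eq; rewrite /GRing.scale/=.
  rewrite tricomi_kerDp// (_ : - p - 1 = - p - 2 + 1); last by ring.
  rewrite tricomi_kerDq//; field.
  by rewrite (gt_eqF p0) (gt_eqF t0) gt_eqF// addr_gt0.
- rewrite /F ger0_norm ?mulr_ge0 ?tricomi_ker_ge0 ?invr_ge0 ?(ltW p0)//.
  rewrite ger_pMr ?invr_gt0// /tricomi_ker mul0r oppr0 add0r expR_le1.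
  have : ln t <= ln (1 + t) by rewrite ler_ln ?posrE ?addr_gt0// lerDr.
  by move=> /(ler_wpM2l (ltW p0)); lra.
Qed.

Lemma integrable_tricomi_ker x p q : 0 < x -> -1 < p ->
  integrable_pos (tricomi_ker x p q).
Proof.
(* [q + p + 2] is the excess of [q] over the exponent [- p - 2] of the explicit kernel;
   [expR (- (x * t))] absorbs it up to the constant [expR M]. *)
move=> x0 p1; have [M HM] := ln1D_le_affine (q + p + 2) x0.
apply: le_integrable_pos (integrable_posZ (expR M) (integrable_tricomi_ker0 p1)).
  by apply: measurable_pos => t; exact: continuous_tricomi_ker.
move=> t t0; rewrite ger0_norm ?tricomi_ker_ge0// /tricomi_ker -expRD ler_expR.
by have := HM t t0; lra.
Qed.

Lemma expRN_cvgy c : 0 < c -> expR (- (c * t)) @[t --> +oo] --> 0.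
Proof.
move=> c0; have h : (c * t) @[t --> +oo] --> +oo.
  apply/cvgryPge => A; by near=> t; rewrite -ler_pdivrMl.
exact: (cvg_comp _ _ h (@cvgr_expR R)).
Unshelve. all: by end_near. Qed.

Lemma tricomi_ker_cvgy x p q : 0 < x -> tricomi_ker x p q t @[t --> +oo] --> 0.
Proof.
move=> x0; have x20 : 0 < x / 2 by rewrite divr_gt0.
have [M HM] := ln1D_le_affine (`|p| + `|q|) x20.
apply: (@squeeze_cvgr _ _ _ _ (cst 0) (fun t => expR M * expR (- (x / 2 * t)))).
- near=> t; rewrite tricomi_ker_ge0/= /tricomi_ker -expRD ler_expR.
  have t1 : 1 <= t by near: t; exact: nbhs_pinfty_ge.
  have t0 : 0 < t by rewrite (lt_le_trans ltr01).
  have := HM t t0.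
  have l0 : 0 <= ln t by rewrite ln_ge0.
  have lt1 : ln t <= ln (1 + t) by rewrite ler_ln ?posrE ?addr_gt0// lerDr.
  have : p * ln t <= `|p| * ln (1 + t).
    by rewrite (le_trans (ler_wpM2r l0 (ler_norm p)))// ler_wpM2l.
  have : q * ln (1 + t) <= `|q| * ln (1 + t).
    by rewrite ler_wpM2r ?ler_norm// (le_trans l0).
  by lra.
- exact: cvg_cst.
- rewrite -[0](mulr0 (expR M)); apply: cvgM; first exact: cvg_cst.
  exact: expRN_cvgy.
Unshelve. all: by end_near. Qed.

Let expR_ln1D_cvg0 x q :
  expR (- (x * t) + q * ln (1 + t)) @[t --> 0^'+] --> (1 : R).
Proof.
have ? : is_derive (1 + 0 : R) 1 (@ln R) (1 + 0)^-1.
  by apply: is_derive1_ln; rewrite addr0.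
have d : is_derive (0 : R) 1 (fun t => expR (- (x * t) + q * ln (1 + t))) (q - x).
  apply: is_derive_eq; rewrite /GRing.scale/= addr0 ln1 invr1 !mulr0 oppr0 addr0 expR0.
  ring.
have := cvg_at_right_filter (is_derive1_continuous d).
by rewrite mulr0 oppr0 addr0 ln1 mulr0 addr0 expR0.
Qed.

Lemma tricomi_ker_cvg0 x p q : 0 < p -> tricomi_ker x p q t @[t --> 0^'+] --> 0.
Proof.
move=> p0.
have h : (t `^ p * expR (- (x * t) + q * ln (1 + t))) @[t --> 0^'+] --> (0 * 1 : R).
  apply: cvgM; first exact: powR_cvg0.
  exact: expR_ln1D_cvg0.
rewrite mul0r in h; apply: cvg_trans h; apply: near_eq_cvg; near=> t.
have t0 : 0 < t by near: t; exact: nbhs_right_gt.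
rewrite /tricomi_ker /powR gt_eqF// -expRD; congr expR; ring.
Unshelve. all: by end_near. Qed.

Lemma tricomi_ker0_cvg0 x q : tricomi_ker x 0 q t @[t --> 0^'+] --> (1 : R).
Proof.
rewrite (_ : tricomi_ker x 0 q = fun t => expR (- (x * t) + q * ln (1 + t))).
  exact: expR_ln1D_cvg0.
by apply/funext => t; rewrite /tricomi_ker mul0r addr0.
Qed.

Lemma tricomi_int_by_parts x p q : 0 < x -> -1 < p ->
  x * tricomi_int x (p + 1) q =
  (p + 1) * tricomi_int x p q + q * tricomi_int x (p + 1) (q - 1).
Proof.
move=> x0 p1; have p0 : 0 < p + 1 by lra.
have p2 : -1 < p + 1 by lra.
pose f t := - x * tricomi_ker x (p + 1) q t + ((p + 1) * tricomi_ker x p q t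
   + q * tricomi_ker x (p + 1) (q - 1) t).
have i1 := integrable_posZ (- x) (integrable_tricomi_ker q x0 p2).
have i2 := integrable_posZ (p + 1) (integrable_tricomi_ker q x0 p1).
have i3 := integrable_posZ q (integrable_tricomi_ker (q - 1) x0 p2).
have : int_pos f = 0 - 0.
  apply: (@int_pos_FTC _ f (tricomi_ker x (p + 1) q)) => [t t0|t t0|||].
  - rewrite /f; apply: continuousD; last apply: continuousD;
    by (apply: continuousM; [exact: cst_continuous|exact: continuous_tricomi_ker]).
  - apply: (is_derive_eq (is_derive_tricomi_ker _ _ _ t0)); rewrite /f.
    have E : tricomi_ker x p q t = (1 + t) * tricomi_ker x p (q - 1) t.
      by rewrite -tricomi_kerDq// subrK.
    rewrite !tricomi_kerDp// E; field.
    by rewrite !gt_eqF ?addr_gt0.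
  - exact: integrable_posD i1 (integrable_posD i2 i3).
  - exact: tricomi_ker_cvg0.
  - exact: tricomi_ker_cvgy.
rewrite /f int_posD//; last exact: integrable_posD.
rewrite int_posD// !int_posZ//; try exact: integrable_tricomi_ker.
rewrite -/(tricomi_int _ _ _) -/(tricomi_int x p q) -/(tricomi_int x (p + 1) (q - 1)).
by lra.
Qed.

(** The boundary case [p = -1] of the previous identity: the product [(p + 1) * tricomi_int x p q]
    is replaced by the limit 1 of the kernel at [t = 0], since no power of [t] kills the boundary
    term. *)
Lemma tricomi_int_by_parts0 x q : 0 < x ->
  x * tricomi_int x 0 q = 1 + q * tricomi_int x 0 (q - 1).
Proof.
move=> x0; have p1 : -1 < 0 :> R by lra.
pose f t := - x * tricomi_ker x 0 q t + q * tricomi_ker x 0 (q - 1) t.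
have i1 := integrable_posZ (- x) (integrable_tricomi_ker q x0 p1).
have i3 := integrable_posZ q (integrable_tricomi_ker (q - 1) x0 p1).
have : int_pos f = 0 - 1.
  apply: (@int_pos_FTC _ f (tricomi_ker x 0 q)) => [t t0|t t0|||].
  - rewrite /f; apply: continuousD;
    by (apply: continuousM; [exact: cst_continuous|exact: continuous_tricomi_ker]).
  - apply: (is_derive_eq (is_derive_tricomi_ker _ _ _ t0)); rewrite /f.
    have -> : tricomi_ker x 0 q t = (1 + t) * tricomi_ker x 0 (q - 1) t.
      by rewrite -tricomi_kerDq// subrK.
    by field; rewrite !gt_eqF ?addr_gt0.
  - exact: integrable_posD i1 i3.
  - exact: tricomi_ker0_cvg0.
  - exact: tricomi_ker_cvgy.
rewrite /f int_posD// !int_posZ//; try exact: integrable_tricomi_ker.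
rewrite -/(tricomi_int _ _ _) -/(tricomi_int x 0 (q - 1)).
by lra.
Qed.

End tricomi_kernel.

(** * Positivity of the integrals and their derivatives in x and in the exponents *)

Section tricomi_int_theory.
Context {R : realType}.
Implicit Types (x p q c t y : R).

Lemma tricomi_intD x p q : 0 < x -> -1 < p ->
  tricomi_int x p (q + 1) = tricomi_int x p q + tricomi_int x (p + 1) q.
Proof.
move=> x0 p1; have p2 : -1 < p + 1 by lra.
rewrite -int_posD; [|exact: integrable_tricomi_ker..].
apply: eq_int_pos => t t0; rewrite tricomi_kerDq// tricomi_kerDp//; ring.
Qed.

Lemma tricomi_int_nat0 x (n : nat) : 0 < x ->
  tricomi_int x n%:R 0 = n`!%:R / x ^+ n.+1.
Proof.
move=> x0; have x_neq0 : x != 0 by rewrite gt_eqF.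
elim: n => [|n IHn].
  have := tricomi_int_by_parts0 0 x0; rewrite mul0r addr0 => h.
  by apply: (mulfI x_neq0); rewrite h fact0 expr1 mul1r divff.
have n1 : -1 < n%:R :> R by rewrite (@lt_le_trans _ _ 0)// oppr_lt0 ltr01.
have := tricomi_int_by_parts 0 x0 n1; rewrite mul0r addr0 IHn => h.
apply: (mulfI x_neq0); rewrite -natr1 h factS natrM -natr1 [in RHS]exprS.
by field; rewrite expf_neq0.
Qed.

(* A minorant [t^N e^(-(x+1)t)] with [N] natural reduces this to an explicit
   integral. *)
Lemma tricomi_int_gt0 x p q : 0 < x -> -1 < p -> 0 < tricomi_int x p q.
Proof.
move=> x0 p1; have [N pN] : exists N : nat, p <= N%:R.
  by exists (Num.bound `|p|); rewrite (le_trans (ler_norm p))// ltW// archi_boundP.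
have N1 : -1 < N%:R :> R by rewrite (@lt_le_trans _ _ 0)// oppr_lt0 ltr01.
have [M HM] := @ln1D_le_affine R (- (q - N%:R + p)) 1 ltr01.
have x10 : 0 < x + 1 by rewrite addr_gt0.
have i1 := integrable_posZ (expR (- M)) (integrable_tricomi_ker 0 x10 N1).
apply: (@lt_le_trans _ _ (int_pos (fun t => expR (- M) * tricomi_ker (x + 1) N%:R 0 t))).
  rewrite int_posZ; last exact: integrable_tricomi_ker.
  rewrite mulr_gt0 ?expR_gt0// -/(tricomi_int _ _ _) tricomi_int_nat0//.
  by rewrite divr_gt0 ?exprn_gt0// ltr0n fact_gt0.
apply: le_int_pos => //; first exact: integrable_tricomi_ker.
move=> t t0; rewrite /tricomi_ker -expRD ler_expR mul0r addr0.
have := HM t t0.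
have : ln t <= ln (1 + t) by rewrite ler_ln ?posrE ?addr_gt0// lerDr.
have pN0 : 0 <= N%:R - p by rewrite subr_ge0.
by move=> /(ler_wpM2l pN0); lra.
Qed.

Let continuous_oppr t : {for t, continuous (-%R : R -> R)}.
Proof. exact: opp_continuous. Qed.

Let continuous_log p q t : 0 < t ->
  {for t, continuous (fun t => p * ln t + q * ln (1 + t))}.
Proof.
move=> t0; have ? := is_derive1_ln t0.
have ? : is_derive (1 + t) 1 (@ln R) (1 + t)^-1.
  by apply: is_derive1_ln; rewrite addr_gt0.
exact: is_derive1_continuous.
Qed.

Lemma is_derive_tricomi_int x p q : 0 < x -> -1 < p ->
  is_derive x 1 (fun x => tricomi_int x p q) (- tricomi_int x (p + 1) q).
Proof.
move=> x0 p1.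
have kerE y t : expR (p * ln t + q * ln (1 + t) + y * - t) = tricomi_ker y p q t.
  by rewrite /tricomi_ker; congr expR; ring.
have ik y : 0 < y -> integrable_pos (fun t => expR (p * ln t + q * ln (1 + t) + y * - t)).
  by move=> y0; have := integrable_tricomi_ker q y0 p1;
    apply: eq_integrable_pos => t _; rewrite kerE.
have [xh xm xp] : [/\ 0 < x / 2, 0 < x - x / 2 & 0 < x + x / 2] by split; lra.
have [_] := @is_derive_int_pos_expR R (fun t => p * ln t + q * ln (1 + t)) -%R x (x / 2)
  xh (@continuous_log p q) (fun t _ => @continuous_oppr t) (ik _ xm) (ik _ xp).
rewrite (_ : (fun y => int_pos _) = (fun y => tricomi_int y p q)); last first.
  by apply/funext => y; apply: eq_int_pos => t _; exact: kerE.
move=> h; apply: is_derive_eq h _.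
  rewrite -mulN1r -int_posZ; last by apply: integrable_tricomi_ker => //; lra.
  by apply: eq_int_pos => t t0; rewrite kerE tricomi_kerDp// mulN1r mulNr.
Qed.

Definition tricomi_int_ln x p q : R :=
  int_pos (fun t => ln t * tricomi_ker x p q t).

Definition tricomi_int_ln1D x p q : R :=
  int_pos (fun t => ln (1 + t) * tricomi_ker x p q t).

Let is_derive_tricomi_int_dir x p q (u v : R) : 0 < x -> -1 < p ->
  integrable_pos (fun t => (u * ln t + v * ln (1 + t)) * tricomi_ker x p q t) /\
  is_derive (0 : R) 1 (fun y => tricomi_int x (p + y * u) (q + y * v))
    (int_pos (fun t => (u * ln t + v * ln (1 + t)) * tricomi_ker x p q t)).
Proof.
move=> x0 p1.
have kerE y t : expR (- (x * t) + p * ln t + q * ln (1 + t) +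
    y * (u * ln t + v * ln (1 + t))) = tricomi_ker x (p + y * u) (q + y * v) t.
  by rewrite /tricomi_ker; congr expR; ring.
(* Small enough that [p + y * u] stays above -1 for [|y| <= d]; the inner [+ 1] covers [u = 0]. *)
pose d := (p + 1) / (2 * (`|u| + 1)).
have u1 : 0 < `|u| + 1 by rewrite ltr_wpDl.
have d0 : 0 < d by rewrite /d divr_gt0 ?mulr_gt0//; lra.
have du : d * `|u| < p + 1.
  rewrite /d mulrAC ltr_pdivrMr ?mulr_gt0// ltr_pM2l; last by lra.
  by lra.
have ik y : `|y| <= d -> integrable_pos (fun t => expR (- (x * t) + p * ln t +
    q * ln (1 + t) + y * (u * ln t + v * ln (1 + t)))).
  move=> yd; apply: (@eq_integrable_pos _ (tricomi_ker x (p + y * u) (q + y * v))).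
    by move=> t _; rewrite kerE.
  apply: integrable_tricomi_ker => //.
  have : `|y * u| < p + 1 by rewrite normrM (le_lt_trans _ du)// ler_wpM2r.
  by rewrite ltr_norml => /andP[]; lra.
have cA t : 0 < t -> {for t, continuous (fun t => - (x * t) + p * ln t + q * ln (1 + t))}.
  move=> t0; have ? := is_derive1_ln t0.
  have ? : is_derive (1 + t) 1 (@ln R) (1 + t)^-1.
    by apply: is_derive1_ln; rewrite addr_gt0.
  exact: is_derive1_continuous.
have dm : `|0 - d| <= d by rewrite sub0r normrN gtr0_norm.
have dp : `|0 + d| <= d by rewrite add0r gtr0_norm.
have [] := @is_derive_int_pos_expR R _ _ 0 d d0 cA (@continuous_log u v)
  (ik _ dm) (ik _ dp).
rewrite (_ : (fun y => int_pos _) =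
    (fun y => tricomi_int x (p + y * u) (q + y * v))); last first.
  by apply/funext => y; apply: eq_int_pos => t _; exact: kerE.
have E t : (u * ln t + v * ln (1 + t)) * expR (- (x * t) + p * ln t + q * ln (1 + t) +
    0 * (u * ln t + v * ln (1 + t))) =
    (u * ln t + v * ln (1 + t)) * tricomi_ker x p q t.
  by rewrite kerE !mul0r !addr0.
move=> i1 i2; split; first by move: i1; apply: eq_integrable_pos => t _; exact: E.
apply: is_derive_eq i2 _.
by apply: eq_int_pos => t _; exact: E.
Qed.

Lemma integrable_ln_tricomi_ker x p q : 0 < x -> -1 < p ->
  integrable_pos (fun t => ln t * tricomi_ker x p q t).
Proof.
move=> x0 p1; have [h _] := is_derive_tricomi_int_dir q 1 0 x0 p1.
by move: h; apply: eq_integrable_pos => t _; rewrite mul1r mul0r addr0.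
Qed.

Lemma integrable_ln1D_tricomi_ker x p q : 0 < x -> -1 < p ->
  integrable_pos (fun t => ln (1 + t) * tricomi_ker x p q t).
Proof.
move=> x0 p1; have [h _] := is_derive_tricomi_int_dir q 0 1 x0 p1.
by move: h; apply: eq_integrable_pos => t _; rewrite mul1r mul0r add0r.
Qed.

(** Directions (1, 0) and (0, 1) give the recurrences of the logarithmic moments; (1, 1) gives the
    derivative in mu, which moves both exponents of the numerator at once. *)
Lemma is_derive_tricomi_int_exponents x p q (u v : R) : 0 < x -> -1 < p ->
  is_derive (0 : R) 1 (fun y => tricomi_int x (p + y * u) (q + y * v))
    (u * tricomi_int_ln x p q + v * tricomi_int_ln1D x p q).
Proof.
move=> x0 p1; have [_ h] := is_derive_tricomi_int_dir q u v x0 p1.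
apply: is_derive_eq h _.
have i1 := integrable_ln_tricomi_ker q x0 p1.
have i2 := integrable_ln1D_tricomi_ker q x0 p1.
rewrite /tricomi_int_ln /tricomi_int_ln1D -!int_posZ// -int_posD.
- by apply: eq_int_pos => t _; ring.
- exact: integrable_posZ.
- exact: integrable_posZ.
Qed.

End tricomi_int_theory.

(** * Uniqueness of Tricomi's function *)

Section tricomi_function.
Context {R : realType}.
Implicit Types (x p q c t y a b C : R) (u w f : R -> R).

Lemma is_derive0_cst_pos f : (forall x, 0 < x -> is_derive x 1 f 0) ->
  forall x y, 0 < x -> 0 < y -> f x = f y.
Proof.
move=> df x y; wlog xy : x y / x < y => [h x0 y0|x0 y0].
  by have [/h->//|/h->//|->//] := ltgtP x y.
have dI z : z \in `]x, y[ -> is_derive z 1 f ((fun=> 0) z).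
  by rewrite in_itv/= => /andP[xz _]; apply: df; exact: lt_trans xz.
have cf : {within `[x, y], continuous f}.
  apply: derivable_within_continuous => z; rewrite in_itv/= => /andP[xz _].
  by case: (df z (lt_le_trans x0 xz)).
have [z _] := MVT xy dI cf.
by rewrite mul0r => /eqP; rewrite subr_eq0 => /eqP.
Qed.

Lemma powRS a x : 0 < x -> x `^ (a + 1) = x `^ a * x.
Proof.
move=> x0; have x1 : x != 0 by rewrite gt_eqF.
by rewrite powRD ?x1 ?implybT// powRr1// ltW.
Qed.

Lemma is_derive_powRl a x : 0 < x ->
  is_derive x 1 (fun x => x `^ a) (a * x `^ a / x).
Proof.
move=> x0; apply: is_derive_eq (is_derive1_powR a x0) _.
by rewrite -[in RHS](subrK 1 a) powRS//; field; rewrite gt_eqF.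
Qed.

Lemma is_derive_inv x : x != 0 -> is_derive x 1 (fun x : R => x^-1) (- (x ^- 2)).
Proof.
move=> x0; apply: is_derive_eq (is_deriveV (f := id) x0 _) _.
by rewrite /GRing.scale/= mulr1.
Qed.

(** The scaling t -> t / x, without a change of variables: the derivative in [x] of the left-hand
    side vanishes by the integration by parts at [q = 0]. The constant is Gamma(p + 1). *)
Lemma tricomi_int_q0 x p : 0 < x -> -1 < p ->
  x `^ (p + 1) * tricomi_int x p 0 = tricomi_int 1 p 0.
Proof.
move=> x0 p1; pose f x := x `^ (p + 1) * tricomi_int x p 0.
have -> : tricomi_int 1 p 0 = f 1 by rewrite /f powR1 mul1r.
apply: (@is_derive0_cst_pos f) => // {x0}y y0.
have ? := is_derive_powRl (p + 1) y0.
have ? := is_derive_tricomi_int 0 y0 p1.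
apply: is_derive_eq; rewrite /GRing.scale/=.
have := tricomi_int_by_parts 0 y0 p1; rewrite mul0r addr0 => h.
have -> : tricomi_int y p 0 * ((p + 1) * y `^ (p + 1) / y) =
  y `^ (p + 1) / y * ((p + 1) * tricomi_int y p 0) by ring.
by rewrite -h; field; rewrite gt_eqF.
Qed.

Lemma is_tricomiU_intro a b u (u1 u2 : R -> R) :
  (forall x, 0 < x -> is_derive x 1 u (u1 x)) ->
  (forall x, 0 < x -> is_derive x 1 u1 (u2 x)) ->
  (forall x, 0 < x -> x * u2 x + (b - x) * u1 x - a * u x = 0) ->
  (x `^ a * u x @[x --> +oo] --> (1 : R)) -> is_tricomiU a b u.
Proof.
move=> du du1 ode lim; split=> // x x0.
have u1E y : 0 < y -> derive1 u y = u1 y.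
  by move=> y0; rewrite derive1E; case: (du y y0).
have du1' : is_derive x 1 (derive1 u) (u2 x).
  apply: near_eq_is_derive (du1 x x0); near=> y; rewrite u1E//.
  by near: y; exact: lt_nbhsr.
split; [by case: (du x x0)|by case: du1'|].
rewrite u1E// (_ : derive1 (derive1 u) x = u2 x); first exact: ode.
by rewrite derive1E; case: du1'.
Unshelve. all: by end_near. Qed.

Lemma is_tricomiU_derive a b u x : is_tricomiU a b u -> 0 < x ->
  [/\ is_derive x 1 u (derive1 u x), is_derive x 1 (derive1 u) (derive1 (derive1 u) x) &
      x * derive1 (derive1 u) x = a * u x - (b - x) * derive1 u x].
Proof.
move=> [ode _] x0; have [d1 d2 e] := ode x x0.
split; [exact: (DeriveDef d1 (esym (derive1E _ _)))
  |exact: (DeriveDef d2 (esym (derive1E _ _)))|].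
by move: e; lra.
Qed.

(* The denominator is [Gamma(a)]; see [tricomi_int_q0]. *)
Definition tricomiU_int a b x : R :=
  tricomi_int x (a - 1) (b - a - 1) / tricomi_int 1 (a - 1) 0.

Lemma tricomiU_int_gt0 a b x : 0 < a -> 0 < x -> 0 < tricomiU_int a b x.
Proof. by move=> a0 x0; rewrite divr_gt0// tricomi_int_gt0//; lra. Qed.

Let norm_expRB1 (s : R) : `|expR s - 1| <= `|s| * expR `|s|.
Proof.
have h (z : R) : 0 <= z -> expR z - 1 <= z * expR z.
  move=> z0; have := expR_ge1Dx (- z); rewrite expRN.
  rewrite -(ler_pM2r (expR_gt0 z)) mulVf ?gt_eqF ?expR_gt0//; lra.
have [s0|s0] := leP 0 s.
  rewrite (ger0_norm s0) ger0_norm; first exact: h.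
  by have := expR_ge1Dx s; lra.
rewrite (ltr0_norm s0) ltr0_norm; last by rewrite subr_lt0 expR_lt1.
have := expR_ge1Dx s; have e1 : 1 <= expR (- s).
  by have := expR_ge1Dx (- s); lra.
have : - s * 1 <= - s * expR (- s) by rewrite ler_wpM2l//; lra.
lra.
Qed.

(** Since ln (1 + t) <= t, |(1 + t)^q - 1| <= |q| t e^(|q| t): the factor t raises [p] by one, which
    gains a factor 1 / x at infinity, and the exponential lowers [x] by [|q|]. *)
Let tricomi_int_sub_q0 x p q : -1 < p -> `|q| < x ->
  `|tricomi_int x p q - tricomi_int x p 0| <=
  `|q| * tricomi_int (x - `|q|) (p + 1) 0.
Proof.
move=> p1 qx; have x0 : 0 < x by rewrite (le_lt_trans _ qx).
have xq0 : 0 < x - `|q| by rewrite subr_gt0.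
have p2 : -1 < p + 1 by lra.
have i1 := integrable_tricomi_ker q x0 p1.
have i2 := integrable_posZ (-1) (integrable_tricomi_ker 0 x0 p1).
have i3 := integrable_posZ `|q| (integrable_tricomi_ker 0 xq0 p2).
have -> : tricomi_int x p q - tricomi_int x p 0 =
    int_pos (fun t => tricomi_ker x p q t + -1 * tricomi_ker x p 0 t).
  by rewrite int_posD// int_posZ ?mulN1r//; exact: integrable_tricomi_ker.
apply: (le_trans (norm_int_pos_le (integrable_posD i1 i2))).
rewrite -int_posZ; last exact: integrable_tricomi_ker.
have bnd t : 0 < t -> `|tricomi_ker x p q t + -1 * tricomi_ker x p 0 t| <=
    `|q| * tricomi_ker (x - `|q|) (p + 1) 0 t.
  move=> t0.
  have -> : tricomi_ker x p q t = tricomi_ker x p 0 t * expR (q * ln (1 + t)).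
    by rewrite /tricomi_ker -expRD; congr expR; ring.
  have -> : tricomi_ker (x - `|q|) (p + 1) 0 t =
      tricomi_ker x p 0 t * (t * expR (`|q| * t)).
    rewrite tricomi_kerDp// mulrCA; congr (_ * _).
    by rewrite /tricomi_ker -expRD; congr expR; ring.
  have -> : tricomi_ker x p 0 t * expR (q * ln (1 + t)) + -1 * tricomi_ker x p 0 t =
     tricomi_ker x p 0 t * (expR (q * ln (1 + t)) - 1) by ring.
  rewrite normrM ger0_norm ?tricomi_ker_ge0// mulrCA ler_wpM2l ?tricomi_ker_ge0//.
  apply: (le_trans (norm_expRB1 _)); rewrite mulrA.
  have l0 : 0 <= ln (1 + t) by rewrite ln_ge0// lerDl ltW.
  have lt_ : ln (1 + t) <= t by rewrite le_ln1Dx//; lra.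
  have qt : `|q * ln (1 + t)| <= `|q| * t.
    by rewrite normrM (ger0_norm l0) ler_wpM2l.
  by rewrite ler_pM ?expR_ge0 ?ler_expR.
apply: le_int_pos => //.
apply: le_integrable_pos i3; last by move=> t t0; rewrite normr_id; exact: bnd.
apply: measurableT_comp => //.
exact: measurable_of_integrable_pos (integrable_posD i1 i2).
Qed.

Local Opaque tricomi_int.

Lemma is_tricomiU_int a b : 0 < a -> is_tricomiU a b (tricomiU_int a b).
Proof.
move=> a0.
have [p aE] : exists p, a = p + 1 by exists (a - 1); rewrite subrK.
have [q bE] : exists q, b = q + p + 2 by exists (b - p - 2); ring.
have p1 : -1 < p by move: a0; rewrite aE; lra.
have p2 : -1 < p + 1 by lra.
have [g gE] : exists g, g = tricomi_int 1 p 0 by exists (tricomi_int 1 p 0).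
have g0 : 0 < g by rewrite gE; exact: tricomi_int_gt0.
have -> : tricomiU_int a b = fun x => tricomi_int x p q / g.
  apply/funext => x; rewrite gE /tricomiU_int aE bE.
  have -> : p + 1 - 1 = p by rewrite addrK.
  by have -> : q + p + 2 - (p + 1) - 1 = q by ring.
apply: (@is_tricomiU_intro _ _ _ (fun x => - tricomi_int x (p + 1) q / g)
  (fun x => tricomi_int x (p + 1 + 1) q / g)) => [x x0|x x0|x x0|].
- have ? := is_derive_tricomi_int q x0 p1.
  by apply: is_derive_eq; rewrite /GRing.scale/=; ring.
- have ? := is_derive_tricomi_int q x0 p2.
  by apply: is_derive_eq; rewrite /GRing.scale/=; ring.
(* Kummer's equation is the integration by parts at [q + 1], once (1 + t)^(q+1) is split as (1 +
   t)^q + t (1 + t)^q. *)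
- have := tricomi_int_by_parts (q + 1) x0 p1.
  rewrite addrK !tricomi_intD// => h.
  have -> : x * (tricomi_int x (p + 1 + 1) q / g) +
    (b - x) * (- tricomi_int x (p + 1) q / g) - a * (tricomi_int x p q / g) =
    (x * (tricomi_int x (p + 1) q + tricomi_int x (p + 1 + 1) q) -
    (a * tricomi_int x p q + b * tricomi_int x (p + 1) q)) / g by ring.
  by rewrite h aE bE; ring.
(* The error is at most [B / x]; the power of 2 in [B] comes from [x <= 2 * (x - |q|)], valid once
   [x > 2 * |q|]. *)
- pose B := `|q| * tricomi_int 1 (p + 1) 0 * 2 `^ (p + 2) / g.
  apply/subr_cvg0/norm_cvg0P; apply: (@squeeze_cvgr _ _ _ _ (cst 0) (fun x => B / x)).
  + near=> x; rewrite normr_ge0/=.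
    have x0 : 0 < x by near: x; exact: nbhs_pinfty_gt.
    have xq : 2 * `|q| < x by near: x; exact: nbhs_pinfty_gt.
    have xq1 : `|q| < x by rewrite (le_lt_trans _ xq)// ler_peMl// ler1n.
    have xq0 : 0 < x - `|q| by rewrite subr_gt0.
    have E : x `^ a * tricomi_int x p 0 = g.
      by rewrite aE gE tricomi_int_q0.
    have -> : x `^ a * (tricomi_int x p q / g) - 1 =
        x `^ a * (tricomi_int x p q - tricomi_int x p 0) / g.
      by rewrite mulrBr E; field; rewrite gt_eqF.
    rewrite !normrM (ger0_norm (powR_ge0 _ _)) [`|g^-1|]gtr0_norm ?invr_gt0//.
    rewrite /B [leRHS]mulrAC ler_pM2r ?invr_gt0//.
    apply: (le_trans (ler_wpM2l (powR_ge0 _ _) (tricomi_int_sub_q0 p1 xq1))).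
    rewrite -(tricomi_int_q0 xq0 p2).
    have J0 := tricomi_int_gt0 0 xq0 p2.
    set y := x - `|q| in xq0 J0 *; set J := tricomi_int y (p + 1) 0 in J0 *.
    have h : x `^ a <= y `^ (p + 1 + 1) * 2 `^ (p + 2) / x.
      rewrite ler_pdivlMr//.
      have -> : p + 2 = p + 1 + 1 by ring.
      rewrite -powRM ?(ltW xq0)//.
      have -> : x `^ a * x = x `^ (p + 1 + 1).
        rewrite (_ : p + 1 + 1 = a + 1); last by rewrite aE.
        by rewrite powRS.
      apply: ge0_ler_powR; rewrite ?nnegrE /y; lra.
    have J1 : 0 <= `|q| * J by rewrite mulr_ge0// ltW.
    apply: (le_trans (ler_wpM2r J1 h)); rewrite le_eqVlt; apply/orP; left; apply/eqP; ring.
  + exact: cvg_cst.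
  + rewrite -[0](mulr0 B); apply: cvgM; first exact: cvg_cst.
    apply/gtr0_cvgV0; last exact: cvg_id.
    by near=> x; near: x; exact: nbhs_pinfty_gt.
Unshelve. all: by end_near. Qed.

(* The Wronskian of two solutions is [C x^(-b) e^x], so the derivative of
   [w / u] would blow up unless [C = 0]; but [w / u] tends to 1. *)
Lemma tricomiU_unique a b u w : is_tricomiU a b u ->
  (forall x, 0 < x -> 0 < u x) -> is_tricomiU a b w ->
  forall x, 0 < x -> w x = u x.
Proof.
move=> Hu u0 Hw.
pose Wr x := derive1 w x * u x - w x * derive1 u x.
pose D x := Wr x * x `^ b * expR (- x).
have D1 : forall x, 0 < x -> D x = D 1.
  move=> x x0; apply: is_derive0_cst_pos => // {x0}x x0.
  have [du1 du2 eu] := is_tricomiU_derive Hu x0.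
  have [dw1 dw2 ew] := is_tricomiU_derive Hw x0.
  have ? := is_derive_powRl b x0.
  rewrite /D /Wr; apply: is_derive_eq; rewrite /GRing.scale/=.
  have x1 : x != 0 by rewrite gt_eqF.
  have eu' : derive1 (derive1 u) x = (a * u x - (b - x) * derive1 u x) / x
    by rewrite -eu mulrC mulKf.
  have ew' : derive1 (derive1 w) x = (a * w x - (b - x) * derive1 w x) / x
    by rewrite -ew mulrC mulKf.
  by rewrite eu' ew'; field.
have [C DC] : exists C, D 1 = C by exists (D 1).
rewrite {}DC in D1.
pose r x := w x / u x.
have dr x : 0 < x -> is_derive x 1 r (C * x `^ (- b) * expR x / u x ^+ 2).
  move=> x0.
  have [du1 du2 eu] := is_tricomiU_derive Hu x0.
  have [dw1 dw2 ew] := is_tricomiU_derive Hw x0.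
  have ux : u x != 0 by rewrite gt_eqF// u0.
  have ? := is_deriveV ux du1.
  rewrite /r; apply: is_derive_eq; rewrite /GRing.scale/=.
  rewrite -(D1 x x0) /D /Wr powRN expRN; field.
  by rewrite ux gt_eqF ?powR_gt0// gt_eqF ?expR_gt0.
have [_ lu] := Hu; have [_ lw] := Hw.
have r1 : r x @[x --> +oo] --> (1 : R).
  have lV : (x `^ a * u x)^-1 @[x --> +oo] --> (1^-1 : R).
    by apply: cvgV => //; exact: oner_neq0.
  have h : ((x `^ a * w x) * (x `^ a * u x)^-1) @[x --> +oo] --> (1 * 1^-1 : R).
    exact: cvgM.
  rewrite invr1 mulr1 in h.
  apply: cvg_trans h; apply: near_eq_cvg; near=> x.
  have x0 : 0 < x by near: x; exact: nbhs_pinfty_gt.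
  have xa := powR_gt0 a x0; have ux := u0 x x0.
  by rewrite /= /r; field; rewrite !gt_eqF.
have C0 : C = 0.
  apply/eqP; apply: contraT => C0; exfalso.
  have aC : 0 < `|C| by rewrite normr_gt0.
  (* For [C] nonzero, (w / u)' is of order x^(2a - b) e^x. Half of the exponential, the slope
     [2^-1], pays for the power, and e^(x/2) is left to grow. *)
  have [M0 HM0] := @ln1D_le_affine R `|2 * a - b| 2^-1 ltac:(by rewrite invr_gt0).
  (* Beyond [M], [3^-1] limits the variation of [r] over a unit interval to less than 2/3, while the
     mean value theorem yields a derivative of size at least 1: [z ^ a * u z <= 2] bounds u^2 by 4
     z^(-2a), and the last condition outweighs that 4. *)
  have [M [_ HM]] : \forall z \near +oo, [/\ 1 <= z, `|1 - r z| < 3^-1,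
      z `^ a * u z <= 2 & 4 <= `|C| * expR (z / 2 - M0)].
    near=> z; split.
    - by near: z; exact: nbhs_pinfty_ge.
    - by near: z; move/cvgrPdist_lt : r1; apply; rewrite invr_gt0.
    - near: z; have := cvgr_le _ lu; apply; lra.
    - rewrite -ler_pdivrMl// -[leLHS]lnK ?posrE ?mulr_gt0 ?invr_gt0// ler_expR.
      rewrite lerBrDr ler_pdivlMr//; near: z; exact: nbhs_pinfty_ge.
  pose y := Num.max M 1 + 1.
  have My : M < y by rewrite (@le_lt_trans _ _ (Num.max M 1)) ?le_max ?lexx// ltrDl.
  have y0 : 0 < y.
    by rewrite addr_gt0// (@lt_le_trans _ _ 1) ?le_max ?lexx ?orbT.
  have dI z : z \in `]y, (y + 1)[ ->
      is_derive z 1 r (C * z `^ (- b) * expR z / u z ^+ 2).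
    by rewrite in_itv/= => /andP[yz _]; apply: dr; exact: lt_trans yz.
  have cI : {within `[y, (y + 1)], continuous r}.
    apply: derivable_within_continuous => z; rewrite in_itv/= => /andP[yz _].
    by case: (dr z (lt_le_trans y0 yz)).
  have yy1 : y < y + 1 by rewrite ltrDl.
  have [z] := MVT yy1 dI cI.
  rewrite in_itv/= => /andP[yz zy] E.
  have [_ ry _ _] := HM y My.
  have [_ ry1 _ _] := HM (y + 1) (lt_trans My yy1).
  have [z1 _ uz gz] := HM z (lt_trans My yz).
  have z0 : 0 < z by exact: lt_trans yz.
  have : `|r (y + 1) - r y| < 1.
    by move: ry ry1; rewrite !ltr_norml => /andP[? ?] /andP[? ?]; apply/andP; split; lra.
  rewrite E [y + 1]addrC addrK mulr1 ltNge => /negP; apply.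
  rewrite !normrM normfV (ger0_norm (expR_ge0 z)) (ger0_norm (powR_ge0 z (- b))).
  rewrite (ger0_norm (sqr_ge0 (u z))).
  rewrite ler_pdivlMr ?exprn_gt0 ?u0// mul1r.
  have zaE : z `^ a = expR (a * ln z) by rewrite /powR gt_eqF.
  have u4 : u z ^+ 2 <= 4 * expR (- (2 * a * ln z)).
    have -> : u z ^+ 2 = (z `^ a * u z) ^+ 2 * expR (- (2 * a * ln z)).
      have -> : (z `^ a * u z) ^+ 2 * expR (- (2 * a * ln z)) =
        u z ^+ 2 * (z `^ a * (z `^ a * expR (- (2 * a * ln z)))) by ring.
      rewrite zaE -!expRD (_ : _ + _ = 0) ?expR0 ?mulr1//; ring.
    rewrite ler_wpM2r ?expR_ge0//.
    have p0 : 0 <= z `^ a * u z by rewrite mulr_ge0 ?powR_ge0// ltW// u0.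
    by rewrite (_ : 4 = 2 ^+ 2 :> R) ?ler_sqr ?nnegrE//; ring.
  apply: (le_trans u4).
  apply: (le_trans (ler_wpM2r (expR_ge0 _) gz)).
  rewrite -!mulrA ler_wpM2l ?normr_ge0// /powR gt_eqF// -!expRD ler_expR.
  have lz : 0 <= ln z by rewrite ln_ge0.
  have := HM0 z z0.
  have : ln z <= ln (1 + z) by rewrite ler_ln ?posrE ?addr_gt0// lerDr.
  move=> /(ler_wpM2l (normr_ge0 (2 * a - b))).
  have := ler_wpM2r lz (ler_norm (- (2 * a - b))); rewrite normrN.
  lra.
move=> x x0.
have r_cst y : 0 < y -> r x = r y.
  move=> y0; apply: is_derive0_cst_pos => // z z0.
  by apply: is_derive_eq (dr z z0) _; rewrite C0 !mul0r.
have : r x = 1.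
  have h : r y @[y --> +oo] --> r x.
    by apply: cvg_near_cst; near=> y; rewrite -r_cst.
  have := cvg_lim (@Rhausdorff R) h => <-.
  exact: (cvg_lim (@Rhausdorff R) r1).
move=> h; have := h; rewrite /r => /(canRL (mulfVK _)) ->; first by rewrite mul1r.
by rewrite gt_eqF// u0.
Unshelve. all: by end_near. Qed.

End tricomi_function.

(** * Kummer's symmetry and the integral form of the Whittaker function *)

Section tricomi_symmetry.
Context {R : realType}.
Implicit Types (a b x kappa mu : R) (u : R -> R).

(** Existence makes the function picked by [xget] a solution; uniqueness then fixes its values at
    positive arguments, whatever the choice. *)
Lemma tricomiUE a b x : 0 < a -> 0 < x -> tricomiU a b x = tricomiU_int a b x.
Proof.
move=> a0; have H := is_tricomiU_int b a0.
apply: (tricomiU_unique H); first by move=> y; exact: tricomiU_int_gt0.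
exact: (@xgetPex _ (fun=> 0) [set u | is_tricomiU a b u] (ex_intro _ _ H)).
Qed.

Lemma is_tricomiU_sym a b u : is_tricomiU a b u ->
  is_tricomiU (a - b + 1) (2 - b) (fun x => x `^ (b - 1) * u x).
Proof.
move=> Hu; pose P x := x `^ (b - 1).
apply: (@is_tricomiU_intro _ _ _ _
  (fun x => P x * ((b - 1) * u x * x^-1 + derive1 u x))
  (fun x => P x * ((b - 1) * (b - 2) * u x * x^-1 * x^-1 +
    2 * (b - 1) * derive1 u x * x^-1 + derive1 (derive1 u) x))) => [x x0|x x0|x x0|].
- have [d1 d2 e] := is_tricomiU_derive Hu x0.
  have ? := is_derive_powRl (b - 1) x0.
  by apply: is_derive_eq; rewrite /GRing.scale/= /P; ring.
- have [d1 d2 e] := is_tricomiU_derive Hu x0.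
  have x1 : x != 0 by rewrite gt_eqF.
  have ? := is_derive_powRl (b - 1) x0; have ? := is_derive_inv x1.
  by rewrite /P; apply: is_derive_eq; rewrite /GRing.scale/=; field.
- have [_ _ e] := is_tricomiU_derive Hu x0.
  have e2 : derive1 (derive1 u) x = (a * u x - (b - x) * derive1 u x) / x.
    by rewrite -e mulrC mulKf// gt_eqF.
  by rewrite -/(P x) e2; field; rewrite gt_eqF.
- have [_ lu] := Hu; apply: cvg_trans lu; apply: near_eq_cvg; near=> x.
  have x0 : x != 0 by rewrite gt_eqF.
  rewrite mulrA -powRD ?x0 ?implybT//; congr (_ `^ _ * _); ring.
Unshelve. all: by end_near. Qed.

(** The first parameter [a - b + 1] may be nonpositive, where the integral diverges. Uniqueness only
    asks for some positive normalized solution, and x^(b-1) times the integral for [(a, b)] is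
    one. *)
Lemma tricomiU_sym a b x : 0 < a -> 0 < x ->
  tricomiU (a - b + 1) (2 - b) x = x `^ (b - 1) * tricomiU a b x.
Proof.
move=> a0 x0; have H := is_tricomiU_sym (is_tricomiU_int b a0).
have v0 y : 0 < y -> 0 < y `^ (b - 1) * tricomiU_int a b y.
  by move=> y0; rewrite mulr_gt0 ?powR_gt0// tricomiU_int_gt0.
have HU := @xgetPex _ (fun=> 0) [set u | is_tricomiU _ _ u] (ex_intro _ _ H).
by rewrite (tricomiUE b a0 x0); exact: (tricomiU_unique H v0 HU x0).
Qed.

Lemma whittakerWN kappa mu x : 0 < 1 / 2 + mu - kappa -> 0 < x ->
  whittakerW kappa (- mu) x = whittakerW kappa mu x.
Proof.
move=> a0 x0; rewrite /whittakerW.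
have -> : 1 / 2 + - mu - kappa = (1 / 2 + mu - kappa) - (1 + 2 * mu) + 1 by field.
have -> : 1 + 2 * - mu = 2 - (1 + 2 * mu) by ring.
rewrite tricomiU_sym//; have x1 : x != 0 by rewrite gt_eqF.
have -> : x `^ (mu + 1 / 2) = x `^ (- mu + 1 / 2) * x `^ (1 + 2 * mu - 1).
  by rewrite -powRD ?x1 ?implybT//; congr (_ `^ _); ring.
by rewrite !mulrA.
Qed.

(** The prefactor x^(mu + 1/2) is x^kappa x^a, and x^a rescales the denominator Gamma(a) to an
    integral at the same [x]. *)
Lemma whittakerWE kappa mu x : 0 < 1 / 2 + mu - kappa -> 0 < x ->
  whittakerW kappa mu x = expR (- x / 2) * x `^ kappa *
    (tricomi_int x (mu - kappa - 1 / 2) (mu + kappa - 1 / 2) /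
     tricomi_int x (mu - kappa - 1 / 2) 0).
Proof.
move=> a0 x0; rewrite /whittakerW (tricomiUE _ a0 x0) /tricomiU_int.
have x1 : x != 0 by rewrite gt_eqF.
have -> : 1 + 2 * mu - (1 / 2 + mu - kappa) - 1 = mu + kappa - 1 / 2 by field.
have pE : 1 / 2 + mu - kappa - 1 = mu - kappa - 1 / 2 by field.
rewrite pE; have p1 : -1 < mu - kappa - 1 / 2 by lra.
rewrite -(tricomi_int_q0 x0 p1).
have -> : mu + 1 / 2 = kappa + (mu - kappa - 1 / 2 + 1) by field.
rewrite (@powRD _ x kappa) ?x1 ?implybT//.
have J := tricomi_int_gt0 0 x0 p1.
have X := powR_gt0 (mu - kappa - 1 / 2 + 1) x0.
by field; rewrite !gt_eqF.
Qed.

End tricomi_symmetry.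

(** * Derivative of the Whittaker function *)

Section whittaker_derivative.
Context {R : realType}.
Implicit Types (x p q y c : R) (n k m : nat).
Local Opaque tricomi_int tricomi_int_ln tricomi_int_ln1D.

Lemma near_eq_is_derive_unique (f g : R -> R) (y df dg : R) :
  (\forall z \near y, f z = g z) ->
  is_derive y 1 f df -> is_derive y 1 g dg -> df = dg.
Proof.
move=> fg Hf Hg; have := near_eq_is_derive fg Hf.
by case: Hg => _ <- [_ <-].
Qed.

Let near0_gt p : -1 < p -> \forall y \near (0 : R), -1 < p + y.
Proof.
move=> p1; near=> y; rewrite -ltrBlDl; near: y; apply: lt_nbhsr.
by rewrite subr_lt0.
Unshelve. all: by end_near. Qed.

(* This and the next two lemmas are the derivatives of the integrations by
   parts with respect to the exponents [p] and [q]. *)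
Lemma tricomi_int_ln_rec x p : 0 < x -> -1 < p ->
  x * tricomi_int_ln x (p + 1) 0 =
  (p + 1) * tricomi_int_ln x p 0 + tricomi_int x p 0.
Proof.
move=> x0 p1; have p2 : -1 < p + 1 by lra.
have h1 := is_derive_tricomi_int_exponents 0 1 0 x0 p1.
have h2 := is_derive_tricomi_int_exponents 0 1 0 x0 p2.
pose f y := x * tricomi_int x (p + 1 + y * 1) (0 + y * 0).
pose g y := (p + 1 + y) * tricomi_int x (p + y * 1) (0 + y * 0).
apply: (@near_eq_is_derive_unique f g 0).
- near=> y; have py : -1 < p + y by near: y; exact: near0_gt.
  rewrite /f /g !mulr1 !mulr0 addr0.
  have := tricomi_int_by_parts 0 x0 py; rewrite mul0r addr0.
  by have -> : p + y + 1 = p + 1 + y by ring.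
- by rewrite /f; apply: is_derive_eq; rewrite /GRing.scale/=; ring.
- by rewrite /g; apply: is_derive_eq; rewrite /GRing.scale/= !mul0r !addr0; ring.
Unshelve. all: by end_near. Qed.

Lemma tricomi_int_ln1D_rec x p : 0 < x -> -1 < p ->
  x * tricomi_int_ln1D x (p + 1) 0 =
  (p + 1) * tricomi_int_ln1D x p 0 + tricomi_int x (p + 1) (-1).
Proof.
move=> x0 p1; have p2 : -1 < p + 1 by lra.
have h1 := is_derive_tricomi_int_exponents 0 0 1 x0 p1.
have h2 := is_derive_tricomi_int_exponents 0 0 1 x0 p2.
have h3 := is_derive_tricomi_int_exponents (-1) 0 1 x0 p2.
pose f y := x * tricomi_int x (p + 1 + y * 0) (0 + y * 1).
pose g y := (p + 1) * tricomi_int x (p + y * 0) (0 + y * 1) +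
  y * tricomi_int x (p + 1 + y * 0) (-1 + y * 1).
apply: (@near_eq_is_derive_unique f g 0).
- near=> y; rewrite /f /g !mulr1 !mulr0 add0r !addr0.
  by rewrite (tricomi_int_by_parts _ x0 p1) [-1 + y]addrC.
- by rewrite /f; apply: is_derive_eq; rewrite /GRing.scale/=; ring.
- by rewrite /g; apply: is_derive_eq; rewrite /GRing.scale/= !mul0r !addr0; ring.
Unshelve. all: by end_near. Qed.

Lemma tricomi_int_ln1D_00 x : 0 < x ->
  x * tricomi_int_ln1D x 0 0 = tricomi_int x 0 (-1).
Proof.
move=> x0; have p1 : -1 < 0 :> R by lra.
have h1 := is_derive_tricomi_int_exponents 0 0 1 x0 p1.
have h3 := is_derive_tricomi_int_exponents (-1) 0 1 x0 p1.
pose f y := x * tricomi_int x (0 + y * 0) (0 + y * 1).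
pose g y := 1 + y * tricomi_int x (0 + y * 0) (-1 + y * 1).
apply: (@near_eq_is_derive_unique f g 0).
- near=> y; rewrite /f /g !mulr1 !mulr0 !add0r.
  by rewrite (tricomi_int_by_parts0 _ x0) [-1 + y]addrC.
- by rewrite /f; apply: is_derive_eq; rewrite /GRing.scale/=; ring.
- by rewrite /g; apply: is_derive_eq; rewrite /GRing.scale/= !mul0r !addr0; ring.
Unshelve. all: by end_near. Qed.

Lemma is_derive_whittakerW n x : 0 < x ->
  is_derive ((n%:R + 1) / 2 : R) (1 : R) (fun mu => whittakerW (n%:R / 2) mu x)
    (expR (- x / 2) * x `^ (n%:R / 2) *
     (x * (tricomi_int_ln x 0 n%:R + tricomi_int_ln1D x 0 n%:R) -
      x ^+ 2 * tricomi_int x 0 n%:R * tricomi_int_ln x 0 0)).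
Proof.
move=> x0; have p1 : -1 < 0 :> R by lra.
have x1 : x != 0 by rewrite gt_eqF.
have h1 := is_derive_tricomi_int_exponents n%:R 1 1 x0 p1.
have h2 := is_derive_tricomi_int_exponents 0 1 0 x0 p1.
pose c := expR (- x / 2) * x `^ (n%:R / 2).
pose f y := c * (tricomi_int x (0 + y * 1) (n%:R + y * 1) *
  (tricomi_int x (0 + y * 1) (0 + y * 0))^-1).
have J0 : tricomi_int x 0 0 = x^-1.
  by have := tricomi_int_nat0 0 x0; rewrite fact0 expr1 mul1r.
have df : is_derive (0 : R) 1 f (c * (x * (tricomi_int_ln x 0 n%:R + tricomi_int_ln1D x 0 n%:R) -
      x ^+ 2 * tricomi_int x 0 n%:R * tricomi_int_ln x 0 0)).
  have J1 : tricomi_int x (0 + 0 * 1) (0 + 0 * 0) != 0.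
    by rewrite !mul0r !addr0 J0 invr_neq0.
  have ? := is_deriveV (f := fun y => tricomi_int x (0 + y * 1) (0 + y * 0)) J1 h2.
  rewrite /f; apply: is_derive_eq; rewrite /GRing.scale/= !mul0r !addr0 J0 !invrK.
  by field.
pose mu0 : R := (n%:R + 1) / 2.
have ds : is_derive mu0 1 (fun mu : R => mu - mu0) (1 : R).
  by apply: is_derive_eq; rewrite ?subr0 ?addr0 ?add0r.
have df' : is_derive (mu0 - mu0) 1 f (c * (x * (tricomi_int_ln x 0 n%:R + tricomi_int_ln1D x 0 n%:R) -
      x ^+ 2 * tricomi_int x 0 n%:R * tricomi_int_ln x 0 0)) by rewrite subrr.
have := is_derive1_comp (g := fun mu => mu - mu0) df' ds; rewrite mulr1; apply: near_eq_is_derive.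
near=> mu.
(* Here the first parameter of U is 1 + (mu - mu0), so this keeps it above 1/2. *)
have mu_gt : mu0 - 1 / 2 < mu.
  by near: mu; apply: lt_nbhsr; rewrite ltrBlDr ltrDl divr_gt0.
have a0 : 0 < 1 / 2 + mu - n%:R / 2 by move: mu_gt; rewrite /mu0; lra.
rewrite (whittakerWE a0 x0) -/c /comp /f.
have -> : mu - n%:R / 2 - 1 / 2 = 0 + (mu - mu0) * 1 by rewrite /mu0; field.
have -> : mu + n%:R / 2 - 1 / 2 = n%:R + (mu - mu0) * 1 by rewrite /mu0; field.
by rewrite mulr0 addr0.
Unshelve. all: by end_near. Qed.

(** [F k m] stands for an integral weighted by t^k (1 + t)^m, and the hypothesis for splitting off
    one factor 1 + t. It is applied with the further weights 1, ln t and ln (1 + t). *)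
Lemma binomial_expansion_of_pascal (F : nat -> nat -> R) :
  (forall k m, F k m.+1 = F k m + F k.+1 m) ->
  forall k m, F k m = \sum_(0 <= i < m.+1) 'C(m, i)%:R * F (k + i)%N 0%N.
Proof.
move=> FS k m; elim: m k => [|m IHm] k.
  by rewrite big_nat1 bin0 mul1r addn0.
rewrite FS !IHm [RHS]big_nat_recl// [X in X + _ = _]big_nat_recl// !bin0 -addrA.
congr (_ + _); under [in RHS]eq_bigr do rewrite binS natrD mulrDl.
rewrite big_split/= [X in _ = X + _]big_nat_recr//= bin_small// mul0r addr0.
by congr (_ + _); apply: eq_bigr => i _; rewrite addnS ?addSn.
Qed.

Let natrN1 k : -1 < k%:R :> R.
Proof. by rewrite (@lt_le_trans _ _ 0)// oppr_lt0 ltr01. Qed.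

Lemma tricomi_int_binomial x n : 0 < x ->
  tricomi_int x 0 n%:R = \sum_(0 <= k < n.+1) 'C(n, k)%:R * tricomi_int x k%:R 0.
Proof.
move=> x0.
pose F k m := tricomi_int x k%:R m%:R.
have FS k m : F k m.+1 = F k m + F k.+1 m.
  by rewrite /F -!natr1 tricomi_intD.
have := binomial_expansion_of_pascal FS 0 n; rewrite /F mulr0n => ->.
by apply: eq_bigr => k _; rewrite add0n.
Qed.

Lemma tricomi_int_ln_binomial x n : 0 < x ->
  tricomi_int_ln x 0 n%:R = \sum_(0 <= k < n.+1) 'C(n, k)%:R * tricomi_int_ln x k%:R 0.
Proof.
move=> x0.
pose F k m := tricomi_int_ln x k%:R m%:R.
have FS k m : F k m.+1 = F k m + F k.+1 m.
  rewrite /F -!natr1 -int_posD; [|by apply: integrable_ln_tricomi_ker; rewrite ?natr1..].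
  by apply: eq_int_pos => t t0; rewrite tricomi_kerDq// tricomi_kerDp//; ring.
have := binomial_expansion_of_pascal FS 0 n; rewrite /F mulr0n => ->.
by apply: eq_bigr => k _; rewrite add0n.
Qed.

Lemma tricomi_int_ln1D_binomial x n : 0 < x ->
  tricomi_int_ln1D x 0 n%:R = \sum_(0 <= k < n.+1) 'C(n, k)%:R * tricomi_int_ln1D x k%:R 0.
Proof.
move=> x0.
pose F k m := tricomi_int_ln1D x k%:R m%:R.
have FS k m : F k m.+1 = F k m + F k.+1 m.
  rewrite /F -!natr1 -int_posD; [|by apply: integrable_ln1D_tricomi_ker; rewrite ?natr1..].
  by apply: eq_int_pos => t t0; rewrite tricomi_kerDq// tricomi_kerDp//; ring.
have := binomial_expansion_of_pascal FS 0 n; rewrite /F mulr0n => ->.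
by apply: eq_bigr => k _; rewrite add0n.
Qed.

(** After division by k! / x^(k+1) the recurrence adds 1 / (k + 1) at each step; this is the digamma
    relation psi(k + 1) = psi(1) + H_k. *)
Lemma tricomi_int_ln_nat x k : 0 < x ->
  tricomi_int_ln x k%:R 0 =
  k`!%:R / x ^+ k.+1 * (x * tricomi_int_ln x 0 0 + harmonic_number R k).
Proof.
move=> x0; have x1 : x != 0 by rewrite gt_eqF.
elim: k => [|k IHk].
  by rewrite /harmonic_number big_geq// addr0 fact0 expr1; field.
apply: (mulfI x1); rewrite -[in LHS]natr1 (tricomi_int_ln_rec x0 (natrN1 k)).
rewrite IHk tricomi_int_nat0// /harmonic_number [in RHS]big_nat_recr//=.
rewrite factS natrM -natr1 [x ^+ k.+2]exprS; field.
by rewrite x1 expf_neq0//= natr1 pnatr_eq0.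
Qed.

(** Each [tricomi_int_ln x k%:R 0] contributes [x * tricomi_int_ln x 0 0] times
    [tricomi_int x k%:R 0]; summed over [k] this cancels the subtracted term and leaves the harmonic
    numbers. *)
Lemma whittaker_derivative_sum x n : 0 < x ->
  x * (tricomi_int_ln x 0 n%:R + tricomi_int_ln1D x 0 n%:R) -
    x ^+ 2 * tricomi_int x 0 n%:R * tricomi_int_ln x 0 0 =
  n`!%:R * \sum_(0 <= k < n.+1) x ^- k / (n - k)`!%:R *
    (harmonic_number R k + x ^+ k.+1 / k`!%:R * tricomi_int_ln1D x k%:R 0).
Proof.
move=> x0; have x1 : x != 0 by rewrite gt_eqF.
rewrite tricomi_int_binomial// tricomi_int_ln_binomial// tricomi_int_ln1D_binomial//.
rewrite -big_split/= !mulr_sumr mulr_suml -sumrB; apply: eq_big_nat => k /andP[_ kn].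
rewrite tricomi_int_nat0// tricomi_int_ln_nat//.
have kf : k`!%:R != 0 :> R by rewrite pnatr_eq0 -lt0n fact_gt0.
have nkf : (n - k)`!%:R != 0 :> R by rewrite pnatr_eq0 -lt0n fact_gt0.
have -> : 'C(n, k)%:R = n`!%:R / (k`!%:R * (n - k)`!%:R) :> R.
  by rewrite -(bin_fact (n := n) (m := k))// !natrM; field; rewrite kf nkf.
by rewrite exprS; field; rewrite x1 kf nkf expf_neq0.
Qed.

End whittaker_derivative.

(** * Incomplete gamma functions *)

Section incomplete_gamma.
Context {R : realType}.
Implicit Types (x z t u : R) (k n j : nat).
Notation mu := (@lebesgue_measure R).
Local Opaque tricomi_int tricomi_int_ln tricomi_int_ln1D.

(* The antiderivative of [t^k e^(-t)] that vanishes at infinity. *)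
Fixpoint gamma_primitive k t : R :=
  if k is j.+1 then k%:R * gamma_primitive j t - t ^+ k * expR (- t)
  else - expR (- t).

Let is_derive_exprn k t : is_derive t 1 (fun t => t ^+ k) (k%:R * t ^+ k.-1).
Proof.
elim: k => [|k IHk].
  by rewrite mul0r; exact: is_derive_cst.
rewrite (_ : (fun t => t ^+ k.+1) = (fun t => t * t ^+ k)); last first.
  by apply/funext => u; rewrite exprS.
apply: is_derive_eq; rewrite /GRing.scale/= -natr1.
by case: k {IHk} => [|k]/=; [ring|rewrite exprS; ring].
Qed.

Lemma is_derive_gamma_primitive k t :
  is_derive t 1 (gamma_primitive k) (t ^+ k * expR (- t)).
Proof.
elim: k => [|k IHk] /=; first by apply: is_derive_eq; rewrite /GRing.scale/=; ring.
have ? := is_derive_exprn k.+1 t.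
by apply: is_derive_eq; rewrite /GRing.scale/=; ring.
Qed.

Lemma gamma_primitive_cvgy k : gamma_primitive k t @[t --> +oo] --> (0 : R).
Proof.
elim: k => [|k IHk] /=.
  rewrite -[0]oppr0; apply: cvgN; exact: cvgr_expR.
have -> : 0 = k.+1%:R * 0 - 0 :> R by rewrite mulr0 subr0.
apply: cvgB; first by apply: cvgM; [exact: cvg_cst|exact: IHk].
have h := @tricomi_ker_cvgy R 1 k.+1%:R 0 ltr01.
apply: cvg_trans h; apply: near_eq_cvg; near=> t.
have t0 : 0 < t by near: t; exact: nbhs_pinfty_gt.
rewrite /tricomi_ker mul1r mul0r addr0 expRD mulrC expRM_natl lnK//.
Unshelve. all: by end_near. Qed.

Lemma continuous_expr_expR k t : {for t, continuous (fun t => t ^+ k * expR (- t))}.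
Proof.
apply: (@is_derive1_continuous _ _ _
  (k%:R * t ^+ k.-1 * expR (- t) - t ^+ k * expR (- t))).
have ? := is_derive_exprn k t.
by apply: is_derive_eq; rewrite /GRing.scale/=; ring.
Qed.

Lemma lower_gammaE k z :
  lower_gamma (k%:Z + 1) z = gamma_primitive k z - gamma_primitive k 0.
Proof.
have E a b : \int[mu]_(t in `[a, b]) (t ^ (k%:Z + 1 - 1) * expR (- t)) =
    \int[mu]_(t in `[a, b]) (t ^+ k * expR (- t)).
  by apply: eq_Rintegral => t _; rewrite addrK.
have seg a b : a < b -> \int[mu]_(t in `[a, b]) (t ^+ k * expR (- t)) =
    gamma_primitive k b - gamma_primitive k a.
  have cf : {within `[a, b], continuous (fun t => t ^+ k * expR (- t))}.
    by apply: continuous_subspaceT => t; exact: continuous_expr_expR.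
  move=> ab; rewrite /Rintegral.
  by rewrite (integral_segment_FTC ab (fun t _ => is_derive_gamma_primitive k t) cf).
rewrite /lower_gamma; have [z0|z0|<-] := ltgtP 0 z.
- by rewrite E seg.
- by rewrite E seg// opprB.
- by rewrite E set_itv1 Rintegral_set1 subrr.
Qed.

Lemma Rintegral_FTCy (f F : R -> R) (a l : R) :
  (forall t, a <= t -> 0 <= f t) ->
  (forall t, a <= t -> {for t, continuous f}) ->
  (forall t, a <= t -> is_derive t 1 F (f t)) ->
  F t @[t --> +oo] --> l ->
  \int[mu]_(t in `[a, +oo[) f t = l - F a.
Proof.
move=> f0 cf dF Fl; apply: Rintegral_ge0_continuous_FTC2y => //.
- apply: continuous_in_subspaceT => t; rewrite inE/= in_itv/= andbT; exact: cf.
- by move=> t /ltW at_; case: (dF t at_).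
- by apply: cvg_at_right_filter; apply: is_derive1_continuous (dF a (lexx a)).
- by move=> t; rewrite in_itv/= andbT => /ltW at_; rewrite derive1E; case: (dF t at_).
Qed.

Lemma gamma_primitiveE n x :
  gamma_primitive n x = - (n`!%:R * expR (- x) * \sum_(0 <= k < n.+1) x ^+ k / k`!%:R).
Proof.
elim: n => [|n IHn] /=.
  by rewrite big_nat1 fact0 expr0 divr1 mulr1 mul1r.
rewrite IHn [in RHS]big_nat_recr//= factS natrM.
have f0 : n`!%:R != 0 :> R by rewrite pnatr_eq0 -lt0n fact_gt0.
have n0 : n.+1%:R != 0 :> R by rewrite pnatr_eq0.
move: (n.+1%:R : R) n0 => N n0.
by field; rewrite f0 n0.
Qed.

Lemma upper_gamma_nat n x : 0 < x ->
  upper_gamma (1 + n%:Z) x = n`!%:R * expR (- x) * \sum_(0 <= k < n.+1) x ^+ k / k`!%:R.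
Proof.
move=> x0; rewrite /upper_gamma.
under eq_Rintegral do rewrite addrAC subrr add0r.
rewrite -[RHS]opprK -gamma_primitiveE -sub0r.
apply: (@Rintegral_FTCy (fun t => t ^+ n * expR (- t))).
- move=> t xt; rewrite mulr_ge0 ?expR_ge0// exprn_ge0//.
  by rewrite ltW// (lt_le_trans x0).
- by move=> t _; exact: continuous_expr_expR.
- by move=> t _; exact: is_derive_gamma_primitive.
- exact: gamma_primitive_cvgy.
Qed.

Let natrN1 k : -1 < k%:R :> R.
Proof. by rewrite (@lt_le_trans _ _ 0)// oppr_lt0 ltr01. Qed.

(** t^k / (1 + t) + t^(k+1) / (1 + t) = t^k. This gives both the derivative that identifies
    Gamma(-k, x) and its recurrence in [k]. *)
Lemma tricomi_int_natN1D k x : 0 < x ->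
  tricomi_int x k%:R (-1) + tricomi_int x k.+1%:R (-1) = k`!%:R / x ^+ k.+1.
Proof.
move=> x0; rewrite -tricomi_int_nat0// -natr1 -tricomi_intD//.
by rewrite addNr.
Qed.

(* As a function of [x], minus the right-hand side is a primitive of
   [x^(-k-1) e^(-x)] that vanishes at infinity. *)
Lemma upper_gamma_oppn k x : 0 < x ->
  upper_gamma (- k%:Z) x = expR (- x) * tricomi_int x k%:R (-1) / k`!%:R.
Proof.
move=> x0.
have kf : k`!%:R != 0 :> R by rewrite pnatr_eq0 -lt0n fact_gt0.
pose F t := - (expR (- t) * tricomi_int t k%:R (-1) / k`!%:R).
pose f t := t ^- k.+1 * expR (- t).
have -> : upper_gamma (- k%:Z) x = \int[mu]_(t in `[x, +oo[) f t.
  apply: eq_Rintegral => t _.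
  by have -> : - k%:Z - 1 = Negz k by rewrite NegzE -addn1 PoszD opprD.
rewrite -[RHS]opprK -sub0r; apply: (@Rintegral_FTCy f F).
- move=> t xt; rewrite mulr_ge0 ?expR_ge0// invr_ge0 exprn_ge0//.
  by rewrite ltW// (lt_le_trans x0).
- move=> t xt; have t0 : 0 < t by exact: lt_le_trans xt.
  have tk : t ^+ k.+1 != 0 by rewrite expf_neq0// gt_eqF.
  apply: continuousM; last first.
    apply: (@is_derive1_continuous _ _ _ (- expR (- t))).
    by apply: is_derive_eq; rewrite /GRing.scale/=; ring.
  apply: continuousV => //; exact: exprn_continuous.
- move=> t xt; have t0 : 0 < t by exact: lt_le_trans xt.
  have ? := is_derive_tricomi_int (-1) t0 (natrN1 k).
  rewrite /F; apply: is_derive_eq; rewrite /GRing.scale/=.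
  have E := tricomi_int_natN1D k t0; rewrite -natr1 in E.
  have -> : tricomi_int t (k%:R + 1) (-1) =
      k`!%:R / t ^+ k.+1 - tricomi_int t k%:R (-1) by rewrite -E addrAC subrr add0r.
  by rewrite /f; field; rewrite kf gt_eqF// exprn_gt0.
- apply/norm_cvg0P; apply: (@squeeze_cvgr _ _ _ _ (cst 0) (fun t => expR (- t))).
  + near=> t; have t1 : 1 <= t by near: t; exact: nbhs_pinfty_ge.
    have t0 : 0 < t by rewrite (lt_le_trans ltr01).
    have T0 : 0 <= tricomi_int t k%:R (-1) by rewrite ltW// tricomi_int_gt0.
    have T1 : 0 <= tricomi_int t k.+1%:R (-1) by rewrite ltW// tricomi_int_gt0.
    rewrite normr_ge0/= /F normrN ger0_norm; last by rewrite divr_ge0 ?mulr_ge0 ?expR_ge0.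
    rewrite -mulrA ger_pMr ?expR_gt0// ler_pdivrMr ?ltr0n ?fact_gt0// mul1r.
    apply: (@le_trans _ _ (k`!%:R / t ^+ k.+1)).
      by rewrite -tricomi_int_natN1D// lerDl.
    by rewrite ler_pdivrMr ?exprn_gt0// ler_peMr// exprn_ege1.
  + exact: cvg_cst.
  + exact: cvgr_expR.
Unshelve. all: by end_near. Qed.

Lemma expint_E1E x : expint_E1 x = upper_gamma (- 0%:Z) x.
Proof. by apply: eq_Rintegral => t _; rewrite oppr0 sub0r mulrC. Qed.

Let is_derive_sum_gamma_primitive (c : nat -> R) n u :
  is_derive u 1 (fun u => \sum_(0 <= j < n) c j * gamma_primitive j u)
    (\sum_(0 <= j < n) c j * (u ^+ j * expR (- u))).
Proof.
elim: n => [|n IHn].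
  rewrite big_geq// (_ : (fun u => _) = cst 0); first exact: is_derive_cst.
  by apply/funext => v; rewrite big_geq.
rewrite (_ : (fun u => _) = (fun u =>
    \sum_(0 <= j < n) c j * gamma_primitive j u + c n * gamma_primitive n u)); last first.
  by apply/funext => v; rewrite big_nat_recr.
have ? := is_derive_gamma_primitive n u.
apply: is_derive_eq; rewrite /GRing.scale/= [RHS]big_nat_recr//=; ring.
Qed.

(** The shift t = u - x followed by the binomial theorem, carried out on primitives: [h] has zero
    derivative, and [h x = h 0] is the claim. *)
Lemma lower_gamma_oppr k x :
  lower_gamma (k%:Z + 1) (- x) =
  - expR x * \sum_(0 <= j < k.+1)
    'C(k, j)%:R * (- x) ^+ (k - j) * lower_gamma (j%:Z + 1) x.
Proof.
pose c j : R := expR x * ('C(k, j)%:R * (- x) ^+ (k - j)).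
pose h u := gamma_primitive k (u - x) - \sum_(0 <= j < k.+1) c j * gamma_primitive j u.
have dh u : is_derive u 1 h 0.
  have d1 := is_derive_gamma_primitive k (u - x).
  have d2 := is_derive_sum_gamma_primitive c k.+1 u.
  rewrite /h; apply: is_derive_eq; rewrite ?addr0 ?subr0 mulr1.
  apply/eqP; rewrite subr_eq0; apply/eqP.
  rewrite addrC exprDn big_mkord mulr_suml; apply: eq_bigr => j _.
  rewrite (_ : - (- x + u) = x - u); last by ring.
  rewrite expRD /c -mulr_natr; ring.
have := is_derive_0_is_cst x 0 dh; rewrite /h subrr sub0r.
rewrite lower_gammaE.
have -> : - expR x * \sum_(0 <= j < k.+1)
      'C(k, j)%:R * (- x) ^+ (k - j) * lower_gamma (j%:Z + 1) x =
    - (\sum_(0 <= j < k.+1) c j * gamma_primitive j x -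
       \sum_(0 <= j < k.+1) c j * gamma_primitive j 0).
  rewrite mulNr -sumrB mulr_sumr; congr (- _); apply: eq_bigr => j _.
  by rewrite lower_gammaE /c; ring.
by lra.
Qed.

Lemma lower_gammaS k z :
  lower_gamma (k.+1%:Z + 1) z = k.+1%:R * lower_gamma (k%:Z + 1) z - z ^+ k.+1 * expR (- z).
Proof. by rewrite !lower_gammaE /= expr0n /=; ring. Qed.

Lemma upper_gamma_oppnS k x : 0 < x ->
  upper_gamma (- k%:Z) x =
  x ^- k.+1 * expR (- x) - k.+1%:R * upper_gamma (- k.+1%:Z) x.
Proof.
move=> x0; rewrite !upper_gamma_oppn// factS natrM.
have kf : k`!%:R != 0 :> R by rewrite pnatr_eq0 -lt0n fact_gt0.
have k0 : k.+1%:R != 0 :> R by rewrite pnatr_eq0.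
have xk : x ^+ k.+1 != 0 by rewrite expf_neq0// gt_eqF.
have -> : tricomi_int x k%:R (-1) =
    k`!%:R / x ^+ k.+1 - tricomi_int x k.+1%:R (-1).
  by rewrite -tricomi_int_natN1D// addrK.
move: (k.+1%:R : R) k0 (tricomi_int _ _ _) (x ^+ k.+1) xk => N N0 T X X0.
by field; rewrite N0 X0 kf.
Qed.

Let gamma_sum k x : R :=
  \sum_(1 <= l < k.+1) 'C(k, l)%:R * (- x) ^- l * lower_gamma l%:Z x.

(** Pascal's rule: the terms with ['C(k, l)] restore the sum for [k], and those with ['C(k, l - 1)]
    reassemble through [lower_gamma_oppr] into a single gamma(k + 1, -x). *)
Let gamma_sumS k x : 0 < x ->
  gamma_sum k.+1 x =
  gamma_sum k x + (-1) ^+ k * x ^- k.+1 * expR (- x) * lower_gamma (k%:Z + 1) (- x).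
Proof.
move=> x0; have x1 : x != 0 by rewrite gt_eqF.
pose a l : R := (- x) ^- l.+1 * lower_gamma (l%:Z + 1) x.
have E m : gamma_sum m x = \sum_(0 <= l < m) 'C(m, l.+1)%:R * a l.
  rewrite /gamma_sum big_add1 /=; apply: eq_bigr => l _.
  by rewrite -mulrA -[in l.+1%:Z]addn1 PoszD.
rewrite !E.
under eq_bigr do rewrite binS natrD mulrDl.
rewrite big_split/= [X in X + _ = _]big_nat_recr//= bin_small// mul0r addr0.
congr (_ + _); rewrite lower_gamma_oppr.
have -> : (-1) ^+ k * x ^- k.+1 * expR (- x) *
    (- expR x * \sum_(0 <= j < k.+1)
      'C(k, j)%:R * (- x) ^+ (k - j) * lower_gamma (j%:Z + 1) x) =
    (-1) ^+ k.+1 * x ^- k.+1 * \sum_(0 <= j < k.+1)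
      'C(k, j)%:R * (- x) ^+ (k - j) * lower_gamma (j%:Z + 1) x.
  rewrite expRN [(-1) ^+ k.+1]exprS.
  have ex1 : expR x != 0 by rewrite gt_eqF// expR_gt0.
  have X1 : x ^+ k.+1 != 0 by rewrite expf_neq0.
  move: (\sum_(_ <= _ < _) _) ((-1) ^+ k) (x ^+ k.+1) X1 (expR x) ex1.
  by move=> S s X X1 e e1; field; rewrite X1 e1.
rewrite mulr_sumr; apply: eq_big_nat => l /andP[_ lk].
rewrite /a; have -> : (-1) ^+ k.+1 * x ^- k.+1 = (- x) ^- k.+1.
  by rewrite [(- x) ^+ _]exprNn invfM invr_sign.
have -> : k.+1 = (k - l + l.+1)%N by rewrite addnS subnK.
have nx m : (- x) ^+ m != 0 by rewrite expf_neq0// oppr_eq0.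
by rewrite exprD; field; rewrite !nx.
Qed.

(** From [k] to [k + 1] both sides grow by x^(k+1) e^x Gamma(-k-1, x). On the right, the recurrences
    of the two gamma functions and [gamma_sumS] produce further terms in gamma(k + 1, -x), which
    cancel. At [k = 0] both sides are e^x E_1(x), because gamma(1, -x) = 1 - e^x. *)
Lemma tricomi_int_ln1D_nat k x : 0 < x ->
  x ^+ k.+1 / k`!%:R * tricomi_int_ln1D x k%:R 0 =
  expint_E1 x + ((-1) ^+ k.+1 * upper_gamma (- k%:Z) x * lower_gamma (k%:Z + 1) (- x)
    - \sum_(1 <= l < k.+1) 'C(k, l)%:R * (- x) ^- l * lower_gamma l%:Z x).
Proof.
move=> x0; rewrite -/(gamma_sum k x).
have x1 : x != 0 by rewrite gt_eqF.
have ex1 : expR x != 0 by rewrite gt_eqF// expR_gt0.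
elim: k => [|k IHk].
  rewrite expint_E1E (upper_gamma_oppn 0 x0) fact0.
  rewrite /gamma_sum big_geq// lower_gammaE /= !opprK oppr0 expR0.
  by rewrite !expr1 divr1 tricomi_int_ln1D_00// expRN; field.
have kf : k`!%:R != 0 :> R by rewrite pnatr_eq0 -lt0n fact_gt0.
have k0 : k.+1%:R != 0 :> R by rewrite pnatr_eq0.
have xk : x ^+ k.+1 != 0 by rewrite expf_neq0.
have -> : x ^+ k.+2 / k.+1`!%:R * tricomi_int_ln1D x k.+1%:R 0 =
    x ^+ k.+1 / k`!%:R * tricomi_int_ln1D x k%:R 0 +
    x ^+ k.+1 * expR x * upper_gamma (- k.+1%:Z) x.
  rewrite upper_gamma_oppn// expRN factS natrM.
  have := tricomi_int_ln1D_rec x0 (natrN1 k); rewrite !natr1 => h.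
  have -> : tricomi_int x k.+1%:R (-1) =
    x * tricomi_int_ln1D x k.+1%:R 0 - k.+1%:R * tricomi_int_ln1D x k%:R 0.
    by rewrite h addrC addKr.
  rewrite [x ^+ k.+2]exprS.
  move: (k.+1%:R : R) k0 (tricomi_int_ln1D _ _ _) (tricomi_int_ln1D _ _ _) (x ^+ k.+1) xk.
  move=> N N0 T1 T2 X X0.
  by field; rewrite ex1 N0 kf.
rewrite IHk gamma_sumS// lower_gammaS (upper_gamma_oppnS k x0) opprK.
rewrite expRN [(- x) ^+ _]exprNn ![(-1) ^+ _.+1]exprS.
have s2 : (-1) ^+ k * (-1) ^+ k = 1 :> R by rewrite -exprD addnn -mul2n exprM sqrrN expr1n expr1n.
move: (gamma_sum k x) (upper_gamma _ x) (lower_gamma _ (- x)) (expint_E1 x).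
move: (k.+1%:R : R) (x ^+ k.+1) xk (expR x) ex1 ((-1) ^+ k) s2.
move=> N X X0 e e0 s s2 S G g E1.
have -> : -1 * (-1 * s) * G * (N * g - -1 * s * X * e) =
  s * N * G * g + (s * s) * X * e * G by ring.
by rewrite s2; field; rewrite X0 e0.
Qed.

End incomplete_gamma.

(** Reversal k -> n - k, which gives the exponential sum of Gamma(1 + n, x) the weights of the final
    sum. *)
Lemma sum_exprV_fact_rev (R : realType) (n : nat) (x : R) : x != 0 ->
  \sum_(0 <= k < n.+1) x ^+ k / k`!%:R =
  x ^+ n * \sum_(0 <= k < n.+1) x ^- k / (n - k)`!%:R.
Proof.
move=> x0; rewrite big_nat_rev mulr_sumr; apply: eq_big_nat => k /andP[_ kn].
by rewrite add0n subSS expfB_cond ?(negbTE x0)// mulrA.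
Qed.

(** The summand E_1(x), common to all [k], multiplies the plain sum of the weights, which is x^(-n)
    e^x Gamma(1 + n, x) / n!: this is the origin of the first term. *)
Lemma whittaker_derivative_value (R : realType) (n : nat) (x : R) : 0 < x ->
  expR (- x / 2) * x `^ (n%:R / 2) *
    (x * (tricomi_int_ln x 0 n%:R + tricomi_int_ln1D x 0 n%:R) -
     x ^+ 2 * tricomi_int x 0 n%:R * tricomi_int_ln x 0 0) =
  x `^ (- (n%:R / 2)) * expR (x / 2) * expint_E1 x * upper_gamma (1 + n%:Z) x
  + n`!%:R * x `^ (n%:R / 2) * expR (- x / 2) *
    \sum_(0 <= k < n.+1)
      x ^- k / (n - k)`!%:R *
      (harmonic_number R k
       + (-1) ^+ k.+1 * upper_gamma (- k%:Z) x * lower_gamma (k%:Z + 1) (- x)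
       - \sum_(1 <= l < k.+1) 'C(k, l)%:R * (- x) ^- l * lower_gamma l%:Z x).
Proof.
move=> x0; have x1 : x != 0 by rewrite gt_eqF.
rewrite whittaker_derivative_sum// upper_gamma_nat// sum_exprV_fact_rev//.
set U := (X in x ^+ n * X); set V := (X in _ = _ + _ * X).
have -> : \sum_(0 <= k < n.+1) x ^- k / (n - k)`!%:R * (harmonic_number R k +
    x ^+ k.+1 / k`!%:R * tricomi_int_ln1D x k%:R 0) = U * expint_E1 x + V.
  rewrite mulr_suml -big_split/=; apply: eq_bigr => k _.
  by rewrite tricomi_int_ln1D_nat// addrCA mulrDr addrA.
clearbody U V.
have Y0 : x `^ (n%:R / 2) != 0 by rewrite gt_eqF// powR_gt0.
have YY : x ^+ n = x `^ (n%:R / 2) * x `^ (n%:R / 2).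
  by rewrite -powRD ?x1 ?implybT// -splitr powR_mulrn// ltW.
have e0 : expR (x / 2) != 0 by rewrite gt_eqF// expR_gt0.
have ee : expR x = expR (x / 2) * expR (x / 2) by rewrite -expRD -splitr.
rewrite mulNr powRN !expRN ee YY.
move: (x `^ _) Y0 (expR _) e0 (expint_E1 x) => Y Y0 e e0 E1.
by field; rewrite Y0 e0.
Qed.

Theorem theorem30 (R : realType) (n : nat) (x : R) (hx : 0 < x)
    (s : R) (hs : s = 1 \/ s = -1) :
  is_derive (s * ((n%:R + 1) / 2)) (1 : R)
    (fun mu : R => whittakerW (n%:R / 2) mu x)
    (s * (x `^ (- (n%:R / 2)) * expR (x / 2) * expint_E1 x
          * upper_gamma (1 + n%:Z) x)
     + s * (n`!%:R * x `^ (n%:R / 2) * expR (- x / 2) *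
        \sum_(0 <= k < n.+1)
          x ^- k / (n - k)`!%:R *
          (harmonic_number R k
           + (-1) ^+ k.+1 * upper_gamma (- k%:Z) x
                          * lower_gamma (k%:Z + 1) (- x)
           - \sum_(1 <= l < k.+1)
               'C(k, l)%:R * (- x) ^- l * lower_gamma l%:Z x))).
Proof.
rewrite -mulrDr -(whittaker_derivative_value n hx).
have W := is_derive_whittakerW n hx.
case: hs => ->; first by rewrite !mul1r.
rewrite !mulN1r; set mu0 := (_ + 1) / 2; set D := expR _ * _ * _.
have W' : is_derive (- - mu0) 1 (fun mu => whittakerW (n%:R / 2) mu x) D.
  by rewrite opprK.
have dN : is_derive (- mu0) 1 (-%R : R -> R) (-1 : R) by apply: is_derive_eq.
have := is_derive1_comp (g := -%R) W' dN; rewrite mulrN1; apply: near_eq_is_derive.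
near=> mu.
(* The positivity needed for the reflection concerns [- mu], which thus exceeds [mu0 - 1 / 2]. *)
have mu_lt : mu < - mu0 + 1 / 2.
  by near: mu; apply: lt_nbhsl; rewrite ltrDl divr_gt0.
rewrite -[in RHS](opprK mu) whittakerWN//.
by move: mu_lt; rewrite /mu0; lra.
Unshelve. all: by end_near. Qed.
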